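(* Let $\mathcal D,\mathcal D'\subset\mathbb OP^2$ be projective $3$-designs. Every bijection $\phi:\mathcal D\to\mathcal D'$ preserving Jordan angles (that is, $T(\phi(p),\phi(q))=T(p,q)$ for all $p,q\in\mathcal D$) extends uniquely to an element of $\operatorname{Aut}(J)\cong F_4(\mathbb R)$.
   Context: $J=\operatorname{Herm}_3(\mathbb O)$ is the compact real Albert algebra ($3\times3$ Hermitian octonionic matrices), with Jordan product $\circ$, trace $\operatorname{Tr}$ and positive-definite trace form $T(a,b)=\operatorname{Tr}(a\circ b)$. The Cayley plane is $$\mathbb OP^2=\{p\in J:p\circ p=p,\ \operatorname{Tr}(p)=1,\ p\text{ primitive}\}.$$ The number $T(p,q)$ is called the Jordan angle of $p,q\in\mathbb OP^2$. $\operatorname{Aut}(J)$ is the group of Jordan algebra automorphisms, the compact group $F_4(\mathbb R)$; let $\mu$ be the invariant probability measure on $\mathbb OP^2$ under this group. A finite set $\mathcal D\subset\mathbb OP^2$ is a projective $t$-design if $$\frac1{|\mathcal D|}\sum_{p\in\mathcal D}f(p)=\int_{\mathbb OP^2}f\,d\mu$$ for every restriction $f$ to $\mathbb OP^2$ of a polynomial on $J$ of degree at most $t$. *)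

(* Defs.v *)
From HB Require Import structures.
From mathcomp Require Import all_boot all_order all_algebra.
From mathcomp Require Import ring finmap.
From mathcomp Require Import all_classical all_reals all_analysis.
From mathcomp Require Import -(notations) mpoly.

Set Implicit Arguments.
Unset Strict Implicit.
Unset Printing Implicit Defensive.

Import Order.TTheory GRing.Theory Num.Theory.
Import numFieldNormedType.Exports.

Local Open Scope classical_set_scope.
Local Open Scope ring_scope.

(* One Cayley-Dickson step, with the convention
   (a, b)(c, d) = (ac - d^* b, da + b c^* )  and  (a, b)^* = (a^*, - b). *)
Section CayleyDickson.
Variables (A : zmodType) (mul : A -> A -> A) (conj : A -> A).

Definition cd_mul (x y : A * A) : A * A :=
  (mul x.1 y.1 - mul (conj y.2) x.2, mul y.2 x.1 + mul x.2 (conj y.1)).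

Definition cd_conj (x : A * A) : A * A := (conj x.1, - x.2).

End CayleyDickson.

(* Pitfall: as an iterated product type, [octonion R] inherits a componentwise
   ring structure, which is not the octonion algebra; octonions are multiplied
   with [omul], and matrices of octonions with [omxmul]. *)
Definition octonion (R : realType) : Type :=
  (((R * R) * (R * R)) * ((R * R) * (R * R)))%type.

Section Octonion.
Variable R : realType.
Implicit Types (x y : octonion R) (A B : 'M[octonion R]_3).

Definition omul : octonion R -> octonion R -> octonion R :=
  @cd_mul _ (@cd_mul _ (@cd_mul R *%R id) (@cd_conj R id))
            (@cd_conj _ (@cd_conj R id)).

Definition oconj : octonion R -> octonion R :=
  @cd_conj _ (@cd_conj _ (@cd_conj R id)).

Definition oreal (x : octonion R) : R := x.1.1.1.

Lemma oconjB : {morph oconj : x y / x - y}.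
Proof.
move=> [[[? ?] [? ?]] [[? ?] [? ?]]] [[[? ?] [? ?]] [[? ?] [? ?]]].
by rewrite /oconj /cd_conj /=; do 3!congr pair; rewrite /= opprD.
Qed.

Lemma oconj0 : oconj 0 = 0.
Proof. by have := oconjB 0 0; rewrite !subrr. Qed.

Lemma oconjZ (a : R) x : oconj (a *: x) = a *: oconj x.
Proof.
case: x => [[[? ?] [? ?]] [[? ?] [? ?]]].
by rewrite /oconj /cd_conj /GRing.scale /=; do 3!congr pair; rewrite -scalerN.
Qed.

Lemma oconj_mul x y : oconj (omul x y) = omul (oconj y) (oconj x).
Proof.
case: x => [[[? ?] [? ?]] [[? ?] [? ?]]].
case: y => [[[? ?] [? ?]] [[? ?] [? ?]]].
by rewrite /omul /oconj /cd_conj /cd_mul /=; do 3!congr pair => /=; ring.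
Qed.

Definition omxmul (A B : 'M[octonion R]_3) : 'M[octonion R]_3 :=
  \matrix_(i, j) \sum_k omul (A i k) (B k j).

Definition oadjoint (A : 'M[octonion R]_3) : 'M[octonion R]_3 :=
  map_mx oconj A^T.

Definition ohermitian : {pred 'M[octonion R]_3} := fun A => oadjoint A == A.

Lemma ohermitianP A : reflect (oadjoint A = A) (A \in ohermitian).
Proof. exact: eqP. Qed.

Lemma ohermitian_zmod_closed : zmod_closed ohermitian.
Proof.
split=> [|A B /ohermitianP hA /ohermitianP hB]; apply/ohermitianP.
  by apply/matrixP => i j; rewrite !mxE oconj0.
by apply/matrixP => i j; rewrite -{2}hA -{2}hB !mxE oconjB.
Qed.

HB.instance Definition _ :=
  GRing.isZmodClosed.Build 'M[octonion R]_3 ohermitian ohermitian_zmod_closed.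

Definition oscalemx (a : R) (A : 'M[octonion R]_3) : 'M[octonion R]_3 :=
  map_mx (fun x : octonion R => a *: x) A.

Lemma oscalemx_herm a A : A \in ohermitian -> oscalemx a A \in ohermitian.
Proof.
move=> /ohermitianP hA; apply/ohermitianP/matrixP => i j.
by rewrite -{2}hA !mxE oconjZ.
Qed.

Lemma oconj_sum (I : Type) (r : seq I) (F : I -> octonion R) :
  oconj (\sum_(i <- r) F i) = \sum_(i <- r) oconj (F i).
Proof.
elim: r => [|i r IHr]; first by rewrite !big_nil oconj0.
rewrite !big_cons -IHr -[X in _ + X]opprK oconjB.
by rewrite -[in oconj (- _)]sub0r oconjB oconj0 sub0r opprK.
Qed.

Lemma oadjointM A B : oadjoint (omxmul A B) = omxmul (oadjoint B) (oadjoint A).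
Proof.
apply/matrixP => i j; rewrite !mxE oconj_sum.
by apply: eq_bigr => k _; rewrite oconj_mul !mxE.
Qed.

Definition ojordanmx (A B : 'M[octonion R]_3) : 'M[octonion R]_3 :=
  oscalemx 2^-1 (omxmul A B + omxmul B A).

Lemma ojordanmx_herm A B : A \in ohermitian -> B \in ohermitian ->
  ojordanmx A B \in ohermitian.
Proof.
move=> /ohermitianP hA /ohermitianP hB; apply: oscalemx_herm.
apply/ohermitianP; rewrite -[in RHS]hA -[in RHS]hB -!oadjointM addrC.
apply/matrixP => i j; rewrite !mxE -[X in _ + X]opprK oconjB.
by rewrite -[in oconj (- _)]sub0r oconjB oconj0 sub0r opprK.
Qed.

Record albert := Albert { albert_mx :> 'M[octonion R]_3;
                          _ : albert_mx \in ohermitian }.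

HB.instance Definition _ := [isSub for albert_mx].
HB.instance Definition _ := [Choice of albert by <:].
HB.instance Definition _ := [SubChoice_isSubZmodule of albert by <:].

Definition albert_scale (a : R) (x : albert) : albert :=
  Albert (oscalemx_herm a (valP x)).

Fact albert_scaleA a b (x : albert) :
  albert_scale a (albert_scale b x) = albert_scale (a * b) x.
Proof. by apply/val_inj/matrixP => i j; rewrite !mxE scalerA. Qed.

Fact albert_scale1 : left_id 1 albert_scale.
Proof. by move=> x; apply/val_inj/matrixP => i j; rewrite !mxE scale1r. Qed.

Fact albert_scaleDr : right_distributive albert_scale +%R.
Proof. by move=> a x y; apply/val_inj/matrixP => i j; rewrite !mxE scalerDr. Qed.

Fact albert_scaleDl (x : albert) : {morph albert_scale^~ x : a b / a + b}.
Proof. by move=> a b; apply/val_inj/matrixP => i j; rewrite !mxE scalerDl. Qed.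

HB.instance Definition _ := GRing.Zmodule_isLmodule.Build R albert
  albert_scaleA albert_scale1 albert_scaleDr albert_scaleDl.

HB.instance Definition _ := isPointed.Build albert 0.

(* The open sets of [albert] for the topology induced by the matrix space, that
   is, for the Euclidean topology of the 27-dimensional space J. *)
Definition albert_open : set (set albert) :=
  [set albert_mx @^-1` U | U in [set U : set 'M[octonion R]_3 | open U]].

Definition borel_albert := g_sigma_algebraType albert_open.

Definition jordan (x y : albert) : albert :=
  Albert (ojordanmx_herm (valP x) (valP y)).

(* The diagonal entries of a Hermitian matrix are real octonions, so taking the
   real part only turns them into elements of R. *)
Definition albert_tr (x : albert) : R := \sum_i oreal (albert_mx x i i).

Definition trace_form (x y : albert) : R := albert_tr (jordan x y).

Definition is_idempotent (p : albert) : Prop := jordan p p = p.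

Definition is_primitive (p : albert) : Prop :=
  [/\ is_idempotent p, p != 0 &
      forall u v : albert, is_idempotent u -> is_idempotent v -> jordan u v = 0 ->
        p = u + v -> u = 0 \/ v = 0].

Definition cayley_plane : set albert :=
  [set p | [/\ jordan p p = p, albert_tr p = 1 & is_primitive p]].

Definition albert_aut : set (albert -> albert) :=
  [set g | [/\ linear g, bijective g &
               {morph g : x y / jordan x y}]].

Definition invariant_prob (mu : probability borel_albert R) : Prop :=
  mu cayley_plane = 1%E /\
  forall g : albert -> albert, albert_aut g ->
  forall A : set borel_albert, measurable A -> mu (g @^-1` A) = mu A.

(* Polynomial functions of degree at most t on the real vector space J: the
   polynomials of degree at most t in finitely many linear forms. Recall that
   [msize] is the total degree plus one. *)
Definition polynomial_deg_le (t : nat) (f : albert -> R) : Prop :=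
  exists (n : nat) (l : 'I_n -> {linear albert -> R^o}) (q : mpoly.mpoly n R),
    (mpoly.msize q <= t.+1)%N /\
    forall x : albert, f x = mpoly.meval (fun i => l i x) q.

Definition projective_design (mu : probability borel_albert R) (t : nat)
    (D : {fset albert}) : Prop :=
  [set` D] `<=` cayley_plane /\
  forall f : albert -> R, polynomial_deg_le t f ->
    (#|` D|%:R^-1 * \sum_(p <- D) f p)%:E =
    (\int[mu]_(p in cayley_plane) (f p)%:E)%E.

End Octonion.

(* Main.v *)
(* Write T for the trace form and E for the average over a design D. Because D is
   a 3-design, E[T(p,x) T(p,y) T(p,z)] is the integral of the same cubic over the
   Cayley plane, hence a symmetric trilinear form invariant under Aut(J). Explicit
   automorphisms (permutations of the coordinates, a rotation, the triality maps
   of Spin(8), sign changes of the octonions) together with the vanishing of the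
   2x2 minors of p determine it:
     273 E[T(p,x) T(p,y) T(p,z)] = T(x o y, z)
       + 2 (Tr x T(y,z) + Tr y T(x,z) + Tr z T(x,y)) + 8 Tr x Tr y Tr z.
   Putting z = 1 gives 39 E[T(p,x) T(p,y)] = T(x,y) + 4 Tr x Tr y, so
   x = E[(39 T(p,x) - 12 Tr x) p]. The linear map
   g x = E[(39 T(p,x) - 12 Tr x) phi(p)] therefore extends phi; it preserves T and
   Tr because phi preserves angles, and it preserves the cubic average, hence
   T(x o y, z), hence the Jordan product. *)

From HB Require Import structures.
Require Import Defs.
From mathcomp Require Import all_boot all_order all_algebra finmap.
From mathcomp Require Import all_classical all_reals all_analysis.
From mathcomp Require Import measurable_realfun ring lra.
From mathcomp Require mpoly.
Set Implicit Arguments.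
Unset Strict Implicit.
Unset Printing Implicit Defensive.
Import Order.TTheory GRing.Theory Num.Theory.
Import numFieldNormedType.Exports.
Local Open Scope classical_set_scope.
Local Open Scope ring_scope.

(** The formula for 273 E[T(p,x) T(p,y) T(p,z)] is obtained by showing that the difference of its
    two sides vanishes, so that only homogeneous conditions on an invariant symmetric trilinear form
    have to be solved. Invariance alone leaves the three-dimensional span of T(x o y, z), the
    symmetrized Tr x T(y,z), and Tr x Tr y Tr z. The minor [xi1 p * xi2 p = odot (off3 p) (off3 p)],
    valid on the Cayley plane, cuts this span down to one line, that of the coefficients 1, 2, 8;
    and 273 = 3 + 2 * 27 + 8 * 27 is the value of this form at x = y = z = 1, where the average is
    1. The integral over the plane is never computed. All that is used of the measure is its
    invariance under the explicit automorphisms and its total mass, which is why linear maps and the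
    plane itself have to be shown Borel measurable. *)

Lemma octonion_eq (R : realType) (a b : octonion R) :
  [/\ [/\ a.1.1.1 = b.1.1.1, a.1.1.2 = b.1.1.2, a.1.2.1 = b.1.2.1 & a.1.2.2 = b.1.2.2] &
   [/\ a.2.1.1 = b.2.1.1, a.2.1.2 = b.2.1.2, a.2.2.1 = b.2.2.1 & a.2.2.2 = b.2.2.2]] -> a = b.
Proof.
case: a => [[[? ?] [? ?]] [[? ?] [? ?]]]; case: b => [[[? ?] [? ?]] [[? ?] [? ?]]].
by move=> /= [[-> -> -> ->] [-> -> -> ->]].
Qed.

Definition oreal_mx (R : realType) (r : R) : octonion R :=
  (((r, 0), (0, 0)), ((0, 0), (0, 0))).

Definition odot (R : realType) (a b : octonion R) : R := oreal (omul a (oconj b)).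

Ltac octcase x := case: x => [[[? ?] [? ?]] [[? ?] [? ?]]].
Ltac oring := apply: octonion_eq; split; split;
  rewrite /odot /oreal_mx /oreal /= /GRing.scale /=; ring.
Ltac ofield := apply: octonion_eq; split; split;
  rewrite /odot /oreal_mx /oreal /= /GRing.scale /=; by field.

Section RawLinear.
Variables (R : nzRingType) (U V : lmodType R) (g : U -> V).

Lemma linear_morphisms : linear g ->
  [/\ {morph g : x y / x + y}, g 0 = 0 & forall r, {morph g : x / r *: x}].
Proof.
move=> gl; have gD x y : g (x + y) = g x + g y by have := gl 1 x y; rewrite !scale1r.
have g0 : g 0 = 0 by apply: (addrI (g 0)); rewrite -gD !addr0.
by split=> // r x; have := gl r x 0; rewrite g0 !addr0.
Qed.

End RawLinear.

(** * Coordinates on J: three real diagonal entries and three octonions *)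

Section Coordinates.
Variable R : realType.
Implicit Types (r s t : R) (a b c u : octonion R) (x y z p q : albert R).

(* With this placement of [b] a cyclic shift of the indices shifts (r1, r2, r3) and
   (a, b, c) cyclically. *)
Definition herm_mx (r1 r2 r3 : R) a b c : 'M[octonion R]_3 :=
  \matrix_(i, j)
    match (i : nat), (j : nat) with
    | 0, 0 => oreal_mx r1 | 0, 1 => c | 0, _ => oconj b
    | 1, 0 => oconj c | 1, 1 => oreal_mx r2 | 1, _ => a
    | _, 0 => b | _, 1 => oconj a | _, _ => oreal_mx r3
    end%N.

Lemma oconjK : involutive (@oconj R).
Proof. by move=> a; apply: octonion_eq; split; split=> /=; rewrite ?opprK. Qed.

Lemma herm_mxP r1 r2 r3 a b c : herm_mx r1 r2 r3 a b c \in @ohermitian R.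
Proof.
apply/ohermitianP/matrixP => i j; rewrite !mxE.
by case: i => [[|[|[|?]]] ?]; case: j => [[|[|[|?]]] ?] //=; rewrite ?oconjK //;
   apply: octonion_eq; split; split=> /=; rewrite ?oppr0.
Qed.

Definition herm3 r1 r2 r3 a b c : albert R := Albert (herm_mxP r1 r2 r3 a b c).

Definition xi1 x : R := oreal (albert_mx x ord0 ord0).
Definition xi2 x : R := oreal (albert_mx x (inord 1) (inord 1)).
Definition xi3 x : R := oreal (albert_mx x (inord 2) (inord 2)).
Definition off1 x : octonion R := albert_mx x (inord 1) (inord 2).
Definition off2 x : octonion R := albert_mx x (inord 2) ord0.
Definition off3 x : octonion R := albert_mx x ord0 (inord 1).

Lemma herm3K x : herm3 (xi1 x) (xi2 x) (xi3 x) (off1 x) (off2 x) (off3 x) = x.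
Proof.
apply/val_inj/matrixP => i j; rewrite /= !mxE /xi1 /xi2 /xi3 /off1 /off2 /off3.
case: x => A /= /ohermitianP hA.
have H k l : A k l = oconj (A l k) by rewrite -{1}hA !mxE.
have Hr k : A k k = oreal_mx (oreal (A k k)).
  have := H k k; case: (A k k) => [[[? ?] [? ?]] [[? ?] [? ?]]] [] /=.
  (* A diagonal entry is its own conjugate, so its seven imaginary coordinates equal their
     opposites. *)
  have N (r : R) : r = - r -> r = 0 by lra.
  by do 7!move=> /N->.
have h1 : inord 1 = lift ord0 ord0 :> 'I_3 by apply: val_inj; rewrite /= inordK.
have h2 : inord 2 = lift ord0 (lift ord0 ord0) :> 'I_3 by apply: val_inj; rewrite /= inordK.
case: i => [[|[|[|?]]] hi]; case: j => [[|[|[|?]]] hj] //=; rewrite -?H -?Hr;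
 by congr (A _ _); apply: val_inj; rewrite /= ?inordK.
Qed.

Lemma herm3_surj x : exists r1 r2 r3 a b c, x = herm3 r1 r2 r3 a b c.
Proof. by exists (xi1 x), (xi2 x), (xi3 x), (off1 x), (off2 x), (off3 x); rewrite herm3K. Qed.

Lemma herm3_xi1 r1 r2 r3 a b c : xi1 (herm3 r1 r2 r3 a b c) = r1.
Proof. by rewrite /xi1 mxE. Qed.
Lemma herm3_xi2 r1 r2 r3 a b c : xi2 (herm3 r1 r2 r3 a b c) = r2.
Proof. by rewrite /xi2 mxE /= inordK. Qed.
Lemma herm3_xi3 r1 r2 r3 a b c : xi3 (herm3 r1 r2 r3 a b c) = r3.
Proof. by rewrite /xi3 mxE /= inordK. Qed.
Lemma herm3_off1 r1 r2 r3 a b c : off1 (herm3 r1 r2 r3 a b c) = a.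
Proof. by rewrite /off1 mxE /= !inordK. Qed.
Lemma herm3_off2 r1 r2 r3 a b c : off2 (herm3 r1 r2 r3 a b c) = b.
Proof. by rewrite /off2 mxE /= !inordK. Qed.
Lemma herm3_off3 r1 r2 r3 a b c : off3 (herm3 r1 r2 r3 a b c) = c.
Proof. by rewrite /off3 mxE /= !inordK. Qed.
Definition coordE := (herm3_xi1, herm3_xi2, herm3_xi3, herm3_off1, herm3_off2, herm3_off3).

Lemma herm3D r1 r2 r3 a b c s1 s2 s3 a' b' c' :
  herm3 r1 r2 r3 a b c + herm3 s1 s2 s3 a' b' c' =
  herm3 (r1 + s1) (r2 + s2) (r3 + s3) (a + a') (b + b') (c + c').
Proof.
apply/val_inj/matrixP => i j; rewrite !mxE.
by case: i => [[|[|[|?]]] ?]; case: j => [[|[|[|?]]] ?] //=; oring.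
Qed.

Lemma herm3Z k r1 r2 r3 a b c :
  k *: herm3 r1 r2 r3 a b c = herm3 (k * r1) (k * r2) (k * r3) (k *: a) (k *: b) (k *: c).
Proof.
apply/val_inj/matrixP => i j; rewrite !mxE.
case: i => [[|[|[|?]]] ?]; case: j => [[|[|[|?]]] ?] //=;
 apply: octonion_eq; split; split; rewrite /= /GRing.scale /=; ring.
Qed.

Lemma herm3_tr r1 r2 r3 a b c : albert_tr (herm3 r1 r2 r3 a b c) = r1 + r2 + r3.
Proof. by rewrite /albert_tr !big_ord_recl big_ord0 !mxE /= addr0 addrA. Qed.

Lemma herm3_jordan r1 r2 r3 a b c s1 s2 s3 a' b' c' :
  jordan (herm3 r1 r2 r3 a b c) (herm3 s1 s2 s3 a' b' c') =
  herm3 (r1 * s1 + odot b b' + odot c c')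
     (r2 * s2 + odot c c' + odot a a')
     (r3 * s3 + odot a a' + odot b b')
     (2^-1 *: ((r2 + r3) *: a' + (s2 + s3) *: a + oconj (omul b c' + omul b' c)))
     (2^-1 *: ((r3 + r1) *: b' + (s3 + s1) *: b + oconj (omul c a' + omul c' a)))
     (2^-1 *: ((r1 + r2) *: c' + (s1 + s2) *: c + oconj (omul a b' + omul a' b))).
Proof.
apply/val_inj/matrixP => i j; rewrite !mxE !big_ord_recl !big_ord0 !mxE.
move: a b c a' b' c' => [[[? ?] [? ?]] [[? ?] [? ?]]] [[[? ?] [? ?]] [[? ?] [? ?]]]
 [[[? ?] [? ?]] [[? ?] [? ?]]] [[[? ?] [? ?]] [[? ?] [? ?]]]
 [[[? ?] [? ?]] [[? ?] [? ?]]] [[[? ?] [? ?]] [[? ?] [? ?]]].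
case: i => [[|[|[|?]]] ?]; case: j => [[|[|[|?]]] ?] //=;
 apply: octonion_eq; split; split; rewrite /odot /oreal_mx /oreal /= /GRing.scale /=; by field.
Qed.

End Coordinates.

Ltac coords x := case: (herm3_surj x) => ? [? [? [? [? [? ->]]]]].

(** * Octonion identities, positivity of the trace form, bilinearity of the Jordan product *)

Section Moufang.
Variable R : realType.
Implicit Types (r s t : R) (a b c u : octonion R) (x y z p q : albert R).

Lemma odot_omul_l u a b : odot (omul u a) (omul u b) = odot u u * odot a b.
Proof. by octcase u; octcase a; octcase b; rewrite /odot /oreal /=; ring. Qed.
Lemma odot_omul_r u a b : odot (omul a u) (omul b u) = odot u u * odot a b.
Proof. by octcase u; octcase a; octcase b; rewrite /odot /oreal /=; ring. Qed.
(** This is the middle Moufang identity. The next two lemmas are the right and the left one, applied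
    to [omul a (oconj u)] and to [omul (oconj u) b] respectively, which is the shape in which the
    action of [lmul_mx] meets them. *)
Lemma moufang_mid a b u : omul (omul u a) (omul b u) = omul (omul u (omul a b)) u.
Proof. by octcase u; octcase a; octcase b; oring. Qed.
Lemma moufang_l u a b :
  omul (omul a (oconj u)) (omul (omul u b) u) = odot u u *: omul (omul a b) u.
Proof. by octcase u; octcase a; octcase b; oring. Qed.
Lemma moufang_r u a b :
  omul (omul (omul u a) u) (omul (oconj u) b) = odot u u *: omul u (omul a b).
Proof. by octcase u; octcase a; octcase b; oring. Qed.
Lemma omulK u a : omul (oconj u) (omul u a) = odot u u *: a.
Proof. by octcase u; octcase a; oring. Qed.
Lemma omulVK u a : omul u (omul (oconj u) a) = odot u u *: a.
Proof. by octcase u; octcase a; oring. Qed.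
Lemma omulKr u a : omul (omul a u) (oconj u) = odot u u *: a.
Proof. by octcase u; octcase a; oring. Qed.
Lemma omulVKr u a : omul (omul a (oconj u)) u = odot u u *: a.
Proof. by octcase u; octcase a; oring. Qed.
Lemma omul_flex u a : omul (omul u a) u = omul u (omul a u).
Proof. by octcase u; octcase a; oring. Qed.
Lemma odot_conj a b : odot (oconj a) (oconj b) = odot a b.
Proof. by octcase a; octcase b; rewrite /odot /oreal /=; ring. Qed.
Lemma odotC a b : odot a b = odot b a.
Proof. by octcase a; octcase b; rewrite /odot /oreal /=; ring. Qed.
Lemma odotDl a b c : odot (a + b) c = odot a c + odot b c.
Proof. by octcase a; octcase b; octcase c; rewrite /odot /oreal /=; ring. Qed.
Lemma odotDr a b c : odot c (a + b) = odot c a + odot c b.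
Proof. by rewrite odotC odotDl !(odotC c). Qed.
Lemma odotZl r a b : odot (r *: a) b = r * odot a b.
Proof. by octcase a; octcase b; rewrite /odot /oreal /= /GRing.scale /=; ring. Qed.
Lemma odotZr r a b : odot a (r *: b) = r * odot a b.
Proof. by rewrite odotC odotZl odotC. Qed.
Lemma omulDl a b c : omul (a + b) c = omul a c + omul b c.
Proof. by octcase a; octcase b; octcase c; oring. Qed.
Lemma omulDr a b c : omul c (a + b) = omul c a + omul c b.
Proof. by octcase a; octcase b; octcase c; oring. Qed.
Lemma omulZl r a b : omul (r *: a) b = r *: omul a b.
Proof. by octcase a; octcase b; oring. Qed.
Lemma omulZr r a b : omul a (r *: b) = r *: omul a b.
Proof. by octcase a; octcase b; oring. Qed.
Lemma oconjD a b : oconj (a + b) = oconj a + oconj b.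
Proof. by octcase a; octcase b; oring. Qed.
Lemma odot_sqr a : odot a a =
  a.1.1.1 ^+ 2 + a.1.1.2 ^+ 2 + a.1.2.1 ^+ 2 + a.1.2.2 ^+ 2 +
  (a.2.1.1 ^+ 2 + a.2.1.2 ^+ 2 + a.2.2.1 ^+ 2 + a.2.2.2 ^+ 2).
Proof. by octcase a; rewrite /odot /oreal /=; ring. Qed.
Lemma odot_ge0 a : 0 <= odot a a.
Proof. by rewrite odot_sqr; do 7?apply: addr_ge0; exact: sqr_ge0. Qed.
Lemma odot_eq0 a : odot a a = 0 -> a = 0.
Proof.
rewrite odot_sqr => h; apply: octonion_eq => /=.
have H (r : R) := sqr_ge0 r.
have := (H a.1.1.1, H a.1.1.2, H a.1.2.1, H a.1.2.2,
         (H a.2.1.1, H a.2.1.2, H a.2.2.1, H a.2.2.2)).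
move=> [[[[h1 h2] h3] h4] [[[h5 h6] h7] h8]].
by split; split; apply/eqP; rewrite -sqrf_eq0; apply/eqP; lra.
Qed.

Lemma oconj_unit u : odot u u = 1 -> odot (oconj u) (oconj u) = 1.
Proof. by rewrite odot_conj. Qed.

Lemma herm3_trace_form r1 r2 r3 a b c s1 s2 s3 a' b' c' :
  trace_form (herm3 r1 r2 r3 a b c) (herm3 s1 s2 s3 a' b' c') =
  r1 * s1 + r2 * s2 + r3 * s3 + 2 * (odot a a' + odot b b' + odot c c').
Proof. rewrite /trace_form herm3_jordan herm3_tr; ring. Qed.

Lemma trace_formC x y : trace_form x y = trace_form y x.
Proof.
case: (herm3_surj x) => r1 [r2 [r3 [a [b [c ->]]]]];
  case: (herm3_surj y) => ? [? [? [? [? [? ->]]]]].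
by rewrite !herm3_trace_form (odotC a) (odotC b) (odotC c); ring.
Qed.

Lemma trace_formDl x y z : trace_form (x + y) z = trace_form x z + trace_form y z.
Proof. by coords x; coords y; coords z; rewrite herm3D !herm3_trace_form !odotDl; ring. Qed.

Lemma trace_formZl r x z : trace_form (r *: x) z = r * trace_form x z.
Proof. by coords x; coords z; rewrite herm3Z !herm3_trace_form !odotZl; ring. Qed.

Lemma trace_form_eq0 x : trace_form x x = 0 -> x = 0.
Proof.
case: (herm3_surj x) => r1 [r2 [r3 [a [b [c ->]]]]]; rewrite herm3_trace_form => h.
have := odot_ge0 a; have := odot_ge0 b; have := odot_ge0 c => hc hb ha.
have := sqr_ge0 r1; have := sqr_ge0 r2; have := sqr_ge0 r3 => h3 h2 h1.
have a0 : odot a a = 0 by lra.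
have b0 : odot b b = 0 by lra.
have c0 : odot c c = 0 by lra.
have := (odot_eq0 a0, odot_eq0 b0, odot_eq0 c0) => -[[-> ->] ->].
have r10 : r1 = 0 by apply/eqP; rewrite -sqrf_eq0; apply/eqP; lra.
have r20 : r2 = 0 by apply/eqP; rewrite -sqrf_eq0; apply/eqP; lra.
have r30 : r3 = 0 by apply/eqP; rewrite -sqrf_eq0; apply/eqP; lra.
by rewrite r10 r20 r30 -[RHS](scale0r (herm3 0 0 0 0 0 0)) herm3Z !mul0r !scale0r.
Qed.

Lemma jordanC x y : jordan x y = jordan y x.
Proof.
by apply: val_inj; congr (oscalemx _ _); exact: addrC.
Qed.

Lemma omxmulDl (A B C : 'M[octonion R]_3) : omxmul (A + B) C = omxmul A C + omxmul B C.
Proof.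
apply/matrixP => i j; rewrite !mxE -big_split; apply: eq_bigr => k _.
by rewrite mxE omulDl.
Qed.

Lemma omxmulDr (A B C : 'M[octonion R]_3) : omxmul C (A + B) = omxmul C A + omxmul C B.
Proof.
apply/matrixP => i j; rewrite !mxE -big_split; apply: eq_bigr => k _.
by rewrite mxE omulDr.
Qed.

Lemma oscalemxD r (A B : 'M[octonion R]_3) :
  oscalemx r (A + B) = oscalemx r A + oscalemx r B.
Proof. by apply/matrixP => i j; rewrite !mxE scalerDr. Qed.

Lemma oscalemxA r s (A : 'M[octonion R]_3) :
  oscalemx r (oscalemx s A) = oscalemx (r * s) A.
Proof. by apply/matrixP => i j; rewrite !mxE scalerA. Qed.

Lemma omxmulZl r (A B : 'M[octonion R]_3) :
  omxmul (oscalemx r A) B = oscalemx r (omxmul A B).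
Proof.
apply/matrixP => i j; rewrite !mxE scaler_sumr; apply: eq_bigr => k _.
by rewrite mxE omulZl.
Qed.

Lemma omxmulZr r (A B : 'M[octonion R]_3) :
  omxmul A (oscalemx r B) = oscalemx r (omxmul A B).
Proof.
apply/matrixP => i j; rewrite !mxE scaler_sumr; apply: eq_bigr => k _.
by rewrite mxE omulZr.
Qed.

Lemma jordanDl x y z : jordan (x + y) z = jordan x z + jordan y z.
Proof.
apply: val_inj => /=; rewrite -oscalemxD /ojordanmx; congr oscalemx.
by rewrite omxmulDl omxmulDr addrACA.
Qed.

Lemma jordanZl r x z : jordan (r *: x) z = r *: jordan x z.
Proof.
apply: val_inj => /=; rewrite /ojordanmx omxmulZl omxmulZr -oscalemxD.
by rewrite !oscalemxA mulrC.
Qed.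

End Moufang.

(** * A rational rotation of J and three sign involutions of the octonions *)

Section Rotation.
Variable R : realType.
Implicit Types (r s t : R) (a b c u : octonion R) (x y z p q : albert R).

Lemma herm3_congr r1 r2 r3 a b c s1 s2 s3 a' b' c' :
  r1 = s1 -> r2 = s2 -> r3 = s3 -> a = a' -> b = b' -> c = c' ->
  herm3 r1 r2 r3 a b c = herm3 s1 s2 s3 a' b' c'.
Proof. by do 6!move=> ->. Qed.

Lemma odotE a b : odot a b = oreal (omul a (oconj b)).
Proof. by []. Qed.

(* For [k = 1] this is conjugation by the rotation of cosine 3/5 and sine 4/5 in the
   plane of the first two coordinates, for [k = -1] by its inverse; the rational
   angle makes every verification a field identity. *)
Definition rot_mx (k : R) x :=
  herm3 ((9 * xi1 x + 16 * xi2 x + 24 * k * oreal (off3 x)) / 25)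
     ((16 * xi1 x + 9 * xi2 x - 24 * k * oreal (off3 x)) / 25)
     (xi3 x)
     (5^-1 *: (3 *: off1 x - (4 * k) *: oconj (off2 x)))
     (5^-1 *: (3 *: off2 x + (4 * k) *: oconj (off1 x)))
     (25^-1 *: (oreal_mx (12 * k * (xi2 x - xi1 x)) + 9 *: off3 x - 16 *: oconj (off3 x))).

Lemma rot_mxE k r1 r2 r3 a b c :
  rot_mx k (herm3 r1 r2 r3 a b c) =
  herm3 ((9 * r1 + 16 * r2 + 24 * k * oreal c) / 25)
     ((16 * r1 + 9 * r2 - 24 * k * oreal c) / 25) r3
     (5^-1 *: (3 *: a - (4 * k) *: oconj b)) (5^-1 *: (3 *: b + (4 * k) *: oconj a))
     (25^-1 *: (oreal_mx (12 * k * (r2 - r1)) + 9 *: c - 16 *: oconj c)).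
Proof. by rewrite /rot_mx !coordE. Qed.

Lemma rot_linear k : linear (rot_mx k).
Proof.
move=> t x y; case: (herm3_surj x) => ? [? [? [a [b [c ->]]]]];
  case: (herm3_surj y) => ? [? [? [a' [b' [c' ->]]]]].
rewrite [in LHS]herm3Z [in LHS]herm3D !rot_mxE herm3Z herm3D.
octcase a; octcase b; octcase c; octcase a'; octcase b'; octcase c'.
apply: herm3_congr; [| | |ofield..]; rewrite /odot /oreal /= /GRing.scale /=; by field.
Qed.

Lemma rot_mxK : cancel (rot_mx 1) (rot_mx (-1)).
Proof.
move=> x; case: (herm3_surj x) => ? [? [? [a [b [c ->]]]]]; rewrite !rot_mxE; octcase a;
  octcase b; octcase c.
apply: herm3_congr; [| | |ofield..]; rewrite /oreal /= /GRing.scale /=; by field.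
Qed.

Lemma rot_mxVK : cancel (rot_mx (-1)) (rot_mx 1).
Proof.
move=> x; case: (herm3_surj x) => ? [? [? [a [b [c ->]]]]]; rewrite !rot_mxE; octcase a;
  octcase b; octcase c.
apply: herm3_congr; [| | |ofield..]; rewrite /oreal /= /GRing.scale /=; by field.
Qed.

Lemma rot_jordan x y : rot_mx 1 (jordan x y) = jordan (rot_mx 1 x) (rot_mx 1 y).
Proof.
case: (herm3_surj x) => ? [? [? [a [b [c ->]]]]];
  case: (herm3_surj y) => ? [? [? [a' [b' [c' ->]]]]].
rewrite [in LHS]herm3_jordan !rot_mxE herm3_jordan !mulr1.
octcase a; octcase b; octcase c; octcase a'; octcase b'; octcase c'.
apply: herm3_congr; [| | |ofield..]; rewrite /odot /oreal /= /GRing.scale /=; by field.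
Qed.

(** [osign1], [osign2] and [osign3] negate the second component at the three Cayley-Dickson levels.
    They are commuting automorphisms of the octonions whose common fixed points are the reals. *)
Definition osign1 a : octonion R := (a.1, - a.2).
Definition osign2 a : octonion R := ((a.1.1, - a.1.2), (a.2.1, - a.2.2)).
Definition osign3 a : octonion R :=
  (((a.1.1.1, - a.1.1.2), (a.1.2.1, - a.1.2.2)), ((a.2.1.1, - a.2.1.2), (a.2.2.1, - a.2.2.2))).

Definition oct_involution (e : octonion R -> octonion R) :=
  [/\ linear e, involutive e, {morph e : a b / omul a b}, {morph e : a / oconj a} &
      forall a, oreal (e a) = oreal a].

Lemma osign1_inv : oct_involution osign1.
Proof.
by split; [move=> k a b; octcase a; octcase b; oring|move=> a; octcase a; oring|move=> a b;
  octcase a; octcase b; oring|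
 move=> a; octcase a; oring|by []].
Qed.
Lemma osign2_inv : oct_involution osign2.
Proof.
by split; [move=> k a b; octcase a; octcase b; oring|move=> a; octcase a; oring|move=> a b;
  octcase a; octcase b; oring|
 move=> a; octcase a; oring|by []].
Qed.
Lemma osign3_inv : oct_involution osign3.
Proof.
by split; [move=> k a b; octcase a; octcase b; oring|move=> a; octcase a; oring|move=> a b;
  octcase a; octcase b; oring|
 move=> a; octcase a; oring|by []].
Qed.
End Rotation.

(** * Unit element and associativity of the trace form *)

Section TraceForm.
Variable R : realType.
Implicit Types (r s t : R) (a b c u : octonion R) (x y z p q : albert R).
Definition jone : albert R := herm3 1 1 1 0 0 0.

Lemma odot0 a : odot a 0 = 0.
Proof. by rewrite -(scale0r a) odotZr mul0r. Qed.

Lemma jordan1 x : jordan x jone = x.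
Proof.
coords x; rewrite herm3_jordan !odot0.
by congr herm3; first [ring | (apply: octonion_eq; split; split; rewrite /= /GRing.scale /=;
  by field)].
Qed.

Lemma trace_form1 x : trace_form x jone = albert_tr x.
Proof. by rewrite /trace_form jordan1. Qed.

(** Octonions are not associative, but the real part of a triple product is cyclic. This is exactly
    what matches the off-diagonal contributions in [trace_form_assoc]. *)
Lemma oreal3 a b c : oreal (omul (omul a b) c) = oreal (omul (omul b c) a).
Proof. by octcase a; octcase b; octcase c; rewrite /oreal /=; ring. Qed.

Lemma odot_oconj_omul a b c : odot (oconj (omul a b)) c = oreal (omul (omul a b) c).
Proof. by octcase a; octcase b; octcase c; rewrite /odot /oreal /=; ring. Qed.

(* Failed conversion tests would otherwise expand octonions into components. *)
Opaque omul oconj odot oreal.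

Lemma trace_form_assoc x y z : trace_form (jordan x y) z = trace_form x (jordan y z).
Proof.
case: (herm3_surj x) => r1 [r2 [r3 [a [b [c ->]]]]].
case: (herm3_surj y) => s1 [s2 [s3 [a' [b' [c' ->]]]]].
case: (herm3_surj z) => t1 [t2 [t3 [a2 [b2 [c2 ->]]]]].
rewrite !herm3_jordan !herm3_trace_form !(odotZl, odotZr, odotDl, odotDr, oconjD).
rewrite (odotC a (oconj _)) (odotC b (oconj _)) (odotC c (oconj _)).
rewrite (odotC a (oconj _)) (odotC b (oconj _)) (odotC c (oconj _)).
rewrite !odot_oconj_omul.
rewrite -(oreal3 a b' c2) (oreal3 b2 c' a) -(oreal3 b c' a2) (oreal3 c2 a' b).
rewrite -(oreal3 c a' b2) (oreal3 a2 b' c).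
move: (odot a a') (odot a a2) (odot a' a2) (odot b b') (odot b b2) (odot b' b2).
move: (odot c c') (odot c c2) (odot c' c2) (oreal _) (oreal _) (oreal _) (oreal _) (oreal _)
  (oreal _).
by move=> *; field.
Qed.

End TraceForm.

(** * The explicit automorphisms *)

Section Automorphisms.
Variable R : realType.
Implicit Types (r s t : R) (a b c u : octonion R) (x y z p q : albert R).

(** Preservation of the trace form travels with the automorphism, so that it only has to be checked
    on explicit maps. *)
Definition isometric_aut (g : albert R -> albert R) :=
  albert_aut g /\ forall x y, trace_form (g x) (g y) = trace_form x y.

Lemma isometric_autP (g h : albert R -> albert R) :
  linear g -> cancel g h -> cancel h g ->
  (forall x y, g (jordan x y) = jordan (g x) (g y)) ->
  (forall x, albert_tr (g x) = albert_tr x) -> isometric_aut g.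
Proof.
move=> gl gh hg gj gt; split; last by move=> x y; rewrite /trace_form -gj gt.
by split=> //; exists h.
Qed.

Definition cycle_mx x := herm3 (xi2 x) (xi3 x) (xi1 x) (off2 x) (off3 x) (off1 x).

Lemma cycle_mxE r1 r2 r3 a b c :
  cycle_mx (herm3 r1 r2 r3 a b c) = herm3 r2 r3 r1 b c a.
Proof. by rewrite /cycle_mx !coordE. Qed.

Lemma cycle_isom : isometric_aut cycle_mx.
Proof.
apply: (@isometric_autP _ (cycle_mx \o cycle_mx)).
- by move=> k x y; coords x; coords y; rewrite !(herm3Z, herm3D, cycle_mxE).
- by move=> x; coords x; rewrite /= !cycle_mxE.
- by move=> x; coords x; rewrite /= !cycle_mxE.
- move=> x y; coords x; coords y; rewrite !(herm3_jordan, cycle_mxE).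
  by congr herm3; rewrite -!addrA; congr (_ + _); rewrite addrC.
- by move=> x; coords x; rewrite !cycle_mxE !herm3_tr; ring.
Qed.

(** Conjugation by the transposition of the first two indices. The conjugates appear because the
    off-diagonal entries are placed cyclically and a transposition reverses the cyclic order. *)
Definition swap_mx x :=
  herm3 (xi2 x) (xi1 x) (xi3 x) (oconj (off2 x)) (oconj (off1 x)) (oconj (off3 x)).

Lemma swap_mxE r1 r2 r3 a b c :
  swap_mx (herm3 r1 r2 r3 a b c) = herm3 r2 r1 r3 (oconj b) (oconj a) (oconj c).
Proof. by rewrite /swap_mx !coordE. Qed.

Lemma swap_isom : isometric_aut swap_mx.
Proof.
apply: (@isometric_autP _ swap_mx).
- by move=> k x y; coords x; coords y; rewrite !(herm3Z, herm3D, swap_mxE) !oconjD !oconjZ.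
- by move=> x; coords x; rewrite /= !swap_mxE !oconjK.
- by move=> x; coords x; rewrite /= !swap_mxE !oconjK.
- move=> x y; case: (herm3_surj x) => r1 [r2 [r3 [a [b [c ->]]]]].
  case: (herm3_surj y) => s1 [s2 [s3 [a' [b' [c' ->]]]]];
    rewrite !(herm3_jordan, swap_mxE) !odot_conj.
  rewrite !(oconjZ, oconjD, oconj_mul, oconjK).
  congr herm3.
  + by rewrite addrAC.
  + by rewrite addrAC.
  + by rewrite addrAC.
  + rewrite (addrC r3) (addrC s3); congr (_ *: (_ + _)); exact: addrC.
  + rewrite (addrC r3) (addrC s3); congr (_ *: (_ + _)); exact: addrC.
  + rewrite (addrC r1) (addrC s1); congr (_ *: (_ + _)); exact: addrC.
- by move=> x; coords x; rewrite !swap_mxE !herm3_tr; ring.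
Qed.

(* Conjugation by the diagonal matrix (u, u^*, 1), an element of Spin(8). *)
Definition lmul_mx u x := herm3 (xi1 x) (xi2 x) (xi3 x)
  (omul (oconj u) (off1 x)) (omul (off2 x) (oconj u)) (omul (omul u (off3 x)) u).

Lemma lmul_mxE u r1 r2 r3 a b c :
  lmul_mx u (herm3 r1 r2 r3 a b c) =
  herm3 r1 r2 r3 (omul (oconj u) a) (omul b (oconj u)) (omul (omul u c) u).
Proof. by rewrite /lmul_mx !coordE. Qed.

Lemma lmulK u : odot u u = 1 -> cancel (lmul_mx u) (lmul_mx (oconj u)).
Proof.
move=> hu x; coords x; rewrite !lmul_mxE oconjK; congr herm3.
- by rewrite omulVK hu scale1r.
- by rewrite omulVKr hu scale1r.
- by rewrite (omul_flex u) omulK omulZl omulKr hu !scale1r.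
Qed.

(** Each off-diagonal entry of a Jordan product contains products of entries from the two other
    blocks, and each of the three pairs of blocks is governed by one Moufang identity. The diagonal
    entries only need the composition law for the norm. *)
Lemma lmul_isom u : odot u u = 1 -> isometric_aut (lmul_mx u).
Proof.
move=> hu; have hu' := oconj_unit hu.
apply: (@isometric_autP _ (lmul_mx (oconj u))).
- by move=> k x y; coords x; coords y; rewrite !(herm3Z, herm3D, lmul_mxE) !(omulDl, omulDr,
  omulZl, omulZr).
- exact: lmulK.
- by have := lmulK hu'; rewrite oconjK.
- move=> x y; case: (herm3_surj x) => r1 [r2 [r3 [a [b [c ->]]]]].
  case: (herm3_surj y) => s1 [s2 [s3 [a' [b' [c' ->]]]]].
  rewrite [in LHS]herm3_jordan !lmul_mxE herm3_jordan.
  rewrite (odot_omul_l (oconj u)).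
  rewrite (odot_omul_r (oconj u)).
  rewrite (odot_omul_r u) (odot_omul_l u).
  rewrite odot_conj hu !mul1r.
  rewrite !(moufang_l u).
  rewrite !(moufang_r u).
  rewrite !(moufang_mid _ _ (oconj u)).
  rewrite hu !scale1r.
  congr herm3.
  + by rewrite -omulDl oconj_mul omulZr !omulDr !omulZr.
  + by rewrite -omulDr oconj_mul omulZl !omulDl !omulZl.
  + rewrite -omulDl -omulDr !oconj_mul oconjK -omul_flex omulZr omulZl !omulDr !omulDl.
    by rewrite !omulZr !omulZl.
- by move=> x; coords x; rewrite lmul_mxE !herm3_tr.
Qed.

Definition entry_mx (e : octonion R -> octonion R) x :=
  herm3 (xi1 x) (xi2 x) (xi3 x) (e (off1 x)) (e (off2 x)) (e (off3 x)).

Lemma entry_mxE e r1 r2 r3 a b c :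
  entry_mx e (herm3 r1 r2 r3 a b c) = herm3 r1 r2 r3 (e a) (e b) (e c).
Proof. by rewrite /entry_mx !coordE. Qed.

Lemma entry_isom e : oct_involution e -> isometric_aut (entry_mx e).
Proof.
move=> [el eK eM eC eR].
have [eD e0 eZ] := linear_morphisms el.
have eO a b : odot (e a) (e b) = odot a b by rewrite !odotE -eC -eM eR.
apply: (@isometric_autP _ (entry_mx e)).
- by move=> k x y; coords x; coords y; rewrite !(herm3Z, herm3D, entry_mxE) !eD !eZ.
- by move=> x; coords x; rewrite !entry_mxE !eK.
- by move=> x; coords x; rewrite !entry_mxE !eK.
- move=> x y; coords x; coords y; rewrite [in LHS]herm3_jordan !entry_mxE herm3_jordan.
  by rewrite !eO !(eZ, eD, eC, eM).
- by move=> x; coords x; rewrite entry_mxE !herm3_tr.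
Qed.

Lemma rot_isom : isometric_aut (@rot_mx R 1).
Proof.
apply: (@isometric_autP _ (@rot_mx R (-1))).
- exact: rot_linear.
- exact: rot_mxK.
- exact: rot_mxVK.
- exact: rot_jordan.
- by move=> x; coords x; rewrite rot_mxE !herm3_tr; field.
Qed.

End Automorphisms.

Transparent omul oconj odot oreal.

(** * Real parts, normalization and an orthonormal basis of the octonions *)

Section RealPart.
Variable R : realType.
Implicit Types (r s t : R) (a b c u : octonion R) (x y z p q : albert R).

Definition oone : octonion R := oreal_mx 1.

Lemma odot_oone : odot oone oone = 1.
Proof. by rewrite /odot /oreal /=; ring. Qed.
Lemma oconj_oone : oconj oone = oone.
Proof. oring. Qed.
Lemma omul_oone a : omul oone a = a.
Proof. octcase a; oring. Qed.
Lemma omulo_one a : omul a oone = a.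
Proof. octcase a; oring. Qed.
Lemma omul0 a : omul a 0 = 0.
Proof. octcase a; oring. Qed.
Lemma o0mul a : omul 0 a = 0.
Proof. octcase a; oring. Qed.
Lemma omulNl a b : omul (- a) b = - omul a b.
Proof. by rewrite -scaleN1r omulZl scaleN1r. Qed.
Lemma omulNr a b : omul a (- b) = - omul a b.
Proof. by rewrite -scaleN1r omulZr scaleN1r. Qed.
Lemma oconjN a : oconj (- a) = - oconj a.
Proof. by rewrite -scaleN1r oconjZ scaleN1r. Qed.
Lemma omul_oconj a : omul (oconj a) a = oreal_mx (odot a a).
Proof. octcase a; oring. Qed.
Lemma oreal_mxE r : oreal_mx r = r *: oone.
Proof. oring. Qed.

(* Averaging over the group generated by the three involutions projects onto the
   real part. *)
Lemma linear_osign_fixed (L : octonion R -> R) :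
  (forall a b, L (a + b) = L a + L b) -> (forall r a, L (r *: a) = r * L a) ->
  (forall a, L (osign1 a) = L a) -> (forall a, L (osign2 a) = L a) ->
  (forall a, L (osign3 a) = L a) -> forall a, L a = oreal a * L oone.
Proof.
move=> LD LZ L1 L2 L3 a.
(* Here [c] is the mean of [b] and [e b]; each use below erases the coordinates negated by one
   involution. *)
have H (e : octonion R -> octonion R) b c : L (e b) = L b -> b + e b = 2 *: c -> L b = L c.
  by move=> h /(congr1 L); rewrite LD LZ h; lra.
case: a => [[[a0 a1] [a2 a3]] [[a4 a5] [a6 a7]]].
rewrite (H _ _ (((a0, a1), (a2, a3)), ((0, 0), (0, 0))) (L1 _)); last by oring.
rewrite (H _ _ (((a0, a1), (0, 0)), ((0, 0), (0, 0))) (L2 _)); last by oring.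
rewrite (H _ _ (oreal_mx a0) (L3 _)); last by oring.
by rewrite oreal_mxE LZ.
Qed.

Lemma octonion_normalize a : exists r u, odot u u = 1 /\ a = r *: u.
Proof.
have [a0|a0] := eqVneq (odot a a) 0.
  by exists 0, oone; rewrite odot_oone scale0r (odot_eq0 a0).
have h : Num.sqrt (odot a a) != 0.
  by rewrite sqrtr_eq0 -ltNge lt_neqAle eq_sym a0 odot_ge0.
exists (Num.sqrt (odot a a)), ((Num.sqrt (odot a a))^-1 *: a).
rewrite odotZl odotZr scalerA divff // scale1r; split => //.
by rewrite mulrA -invfM -expr2 sqr_sqrtr ?odot_ge0 // mulVf.
Qed.

Lemma oconj_imag a : oreal a = 0 -> oconj a = - a.
Proof. by octcase a; rewrite /oreal /= => ->; oring. Qed.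

Lemma oreal_split a : a = oreal a *: oone + (a - oreal a *: oone) /\ oreal (a - oreal a *:
  oone) = 0.
Proof. by octcase a; rewrite /oreal; split; [oring| rewrite /= /GRing.scale /=; ring]. Qed.

Lemma orealZ r a : oreal (r *: a) = r * oreal a.
Proof. by octcase a. Qed.

Definition obasis : seq (octonion R) :=
 [:: (((1, 0), (0, 0)), ((0, 0), (0, 0))); (((0, 1), (0, 0)), ((0, 0), (0, 0)));
     (((0, 0), (1, 0)), ((0, 0), (0, 0))); (((0, 0), (0, 1)), ((0, 0), (0, 0)));
     (((0, 0), (0, 0)), ((1, 0), (0, 0))); (((0, 0), (0, 0)), ((0, 1), (0, 0)));
     (((0, 0), (0, 0)), ((0, 0), (1, 0))); (((0, 0), (0, 0)), ((0, 0), (0, 1)))].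

Lemma obasis_sqr a : \sum_(u <- obasis) odot a u ^+ 2 = odot a a.
Proof. by rewrite !big_cons big_nil; octcase a; rewrite /odot /oreal /=; ring. Qed.

Lemma obasis_unit u : u \in obasis -> odot u u = 1.
Proof.
by rewrite !inE; do 7?[case/orP]; move=> /eqP ->; rewrite /odot /oreal /=; ring.
Qed.

End RealPart.
Opaque omul oconj odot oreal.

(** * The Peirce blocks of J and the action of the automorphisms on them *)

Section Blocks.
Variable R : realType.
Implicit Types (r s t : R) (a b c u : octonion R) (x y z p q : albert R).

Definition diag_unit (i : 'I_3) : albert R :=
  herm3 (i == ord0)%:R (i == inord 1)%:R (i == inord 2)%:R 0 0 0.

Definition offdiag (i : 'I_3) a : albert R :=
  herm3 0 0 0 (if i == ord0 then a else 0) (if i == inord 1 then a else 0)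
     (if i == inord 2 then a else 0).

Notation E := diag_unit.
Notation F := offdiag.
Local Notation i1 := (inord 1 : 'I_3).
Local Notation i2 := (inord 2 : 'I_3).

Lemma ord3_ind (P : 'I_3 -> Prop) : P ord0 -> P i1 -> P i2 -> forall i, P i.
Proof.
move=> h0 h1 h2 [[|[|[|i]]] hi] //.
- by have -> : Ordinal hi = ord0 by apply: val_inj.
- by have -> : Ordinal hi = i1 by apply: val_inj; rewrite /= inordK.
- by have -> : Ordinal hi = i2 by apply: val_inj; rewrite /= inordK.
Qed.

Lemma ord3_eq : (((ord0 == i1 :> 'I_3) = false) * ((ord0 == i2 :> 'I_3) = false) *
  ((i1 == ord0) = false) * ((i1 == i2) = false) * ((i2 == ord0) = false) * ((i2 == i1) =
    false))%type.
Proof. by rewrite -!val_eqE /= !inordK. Qed.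

Definition blockE := (ord3_eq, eqxx, herm3Z, herm3D, scaler0, add0r, addr0, mulr0).

Lemma block_decomp r1 r2 r3 a b c : herm3 r1 r2 r3 a b c =
  r1 *: E ord0 + r2 *: E i1 + r3 *: E i2 + F ord0 a + F i1 b + F i2 c.
Proof. by rewrite /E /F !blockE !mulr1. Qed.

Lemma offdiagD i a b : F i (a + b) = F i a + F i b.
Proof. by rewrite /F herm3D; do 3![case: ifP => _]; rewrite !addr0. Qed.

Lemma offdiagZ i r a : F i (r *: a) = r *: F i a.
Proof. by rewrite /F herm3Z; do 3![case: ifP => _]; rewrite !mulr0 ?scaler0. Qed.

Lemma offdiagN i a : F i (- a) = - F i a.
Proof. by rewrite -scaleN1r offdiagZ scaleN1r. Qed.

Lemma jone_decomp : jone R = E ord0 + E i1 + E i2.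
Proof. by rewrite /E !blockE. Qed.

Lemma cycle_diag : (cycle_mx (E ord0) = E i2) * (cycle_mx (E i1) = E ord0) * (cycle_mx (E i2)
  = E i1).
Proof. by rewrite /E !cycle_mxE !blockE. Qed.

Lemma cycle_off a : (cycle_mx (F ord0 a) = F i2 a) * (cycle_mx (F i1 a) = F ord0 a) *
  (cycle_mx (F i2 a) = F i1 a).
Proof. by rewrite /F !cycle_mxE !blockE. Qed.

Lemma swap_diag : (swap_mx (E ord0) = E i1) * (swap_mx (E i1) = E ord0) * (swap_mx (E i2) = E
  i2).
Proof. by rewrite /E !swap_mxE !blockE !oconj0. Qed.

Lemma swap_off a : (swap_mx (F ord0 a) = F i1 (oconj a)) * (swap_mx (F i1 a) = F ord0 (oconj
  a)) * (swap_mx (F i2 a) = F i2 (oconj a)).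
Proof. by rewrite /F !swap_mxE !blockE !oconj0. Qed.

Lemma lmul_diag u i : lmul_mx u (E i) = E i.
Proof. by rewrite /E lmul_mxE !(omul0, o0mul). Qed.

Lemma lmul_off u a : (lmul_mx u (F ord0 a) = F ord0 (omul (oconj u) a)) *
  (lmul_mx u (F i1 a) = F i1 (omul a (oconj u))) *
  (lmul_mx u (F i2 a) = F i2 (omul (omul u a) u)).
Proof. by rewrite /F !lmul_mxE !blockE !(omul0, o0mul). Qed.

Lemma entry_diag e i : e 0 = 0 -> entry_mx e (E i) = E i.
Proof. by move=> e0; rewrite /E entry_mxE e0. Qed.

Lemma entry_off e i a : e 0 = 0 -> entry_mx e (F i a) = F i (e a).
Proof. by move=> e0; rewrite /F entry_mxE; do 3![case: ifP => _]; rewrite ?e0. Qed.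

Transparent omul oconj odot oreal.
(** These are the blocks on which [G_scalars_eq0] evaluates the rotation. *)
Lemma rot_block :
  [/\ rot_mx 1 (E ord0) = (9 / 25) *: E ord0 + (16 / 25) *: E i1 + (- 12 / 25) *: F i2 (oone R),
   rot_mx 1 (E i2) = E i2 &
   rot_mx 1 (F ord0 (oone R)) = (3 / 5) *: F ord0 (oone R) + (4 / 5) *: F i1 (oone R)].
Proof.
rewrite /E /F !rot_mxE !blockE.
split; apply: herm3_congr; try by rewrite /oreal /= /GRing.scale /=; field.
all: try ofield.
Qed.
Opaque omul oconj odot oreal.

Lemma isom_comp g h : isometric_aut g -> isometric_aut h -> isometric_aut (g \o h : albert R
  -> albert R).
Proof.
move=> [[gl gb gj] gT] [[hl hb hj] hT]; split; last by move=> x y /=; rewrite gT hT.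
split; [|exact: bij_comp|by move=> x y /=; rewrite hj gj].
by move=> k x y /=; rewrite hl gl.
Qed.

(** For u = -1, [lmul_mx] is conjugation by the diagonal matrix (-1, -1, 1); moving it around with
    [cycle_mx] yields the other two diagonal sign changes. The [i]-th one fixes the off-diagonal
    block [i] and negates the two others. *)
Definition sign_mx (i : 'I_3) : albert R -> albert R :=
  let s3 := lmul_mx (- oone R) in
  if i == ord0 then @cycle_mx R \o @cycle_mx R \o s3 \o @cycle_mx R
  else if i == i1 then @cycle_mx R \o s3 \o @cycle_mx R \o @cycle_mx R else s3.

Lemma sign_isom i : isometric_aut (sign_mx i).
Proof.
have h : isometric_aut (lmul_mx (- oone R)).
  by apply: lmul_isom; rewrite -scaleN1r odotZl odotZr odot_oone; ring.
have hc := cycle_isom R.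
rewrite /sign_mx; case: ifP => _.
  exact: (isom_comp (isom_comp (isom_comp hc hc) h) hc).
case: ifP => _; last exact: h.
exact: (isom_comp (isom_comp (isom_comp hc h) hc) hc).
Qed.

Lemma sign_diag i j : sign_mx i (E j) = E j.
Proof.
rewrite /sign_mx; elim/ord3_ind: i; elim/ord3_ind: j;
  rewrite ?blockE /= ?(cycle_diag, lmul_diag) ?(cycle_diag) //.
Qed.

Lemma sign_off i j a : sign_mx i (F j a) = (if i == j then 1 else -1) *: F j a.
Proof.
have e1 b : omul (oconj (- oone R)) b = - b by rewrite oconjN oconj_oone omulNl omul_oone.
have e2 b : omul b (oconj (- oone R)) = - b by rewrite oconjN oconj_oone omulNr omulo_one.
have e3 b : omul (omul (- oone R) b) (- oone R) = b.
  by rewrite omulNl omulNr omulNl opprK omul_oone omulo_one.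
rewrite /sign_mx -offdiagZ.
by elim/ord3_ind: i; elim/ord3_ind: j; rewrite ?blockE /= ?scale1r ?scaleN1r;
  do 4?rewrite ?(cycle_off) ?lmul_off ?e1 ?e2 ?e3.
Qed.

End Blocks.

(** * Vanishing of an invariant symmetric trilinear form subject to the minor relation *)

Section Invariant.
Variable R : realType.
Implicit Types (r s t : R) (a b c u : octonion R) (x y z p q : albert R).
Notation E := (@diag_unit R).
Notation F := (@offdiag R).
Local Notation i0 := (ord0 : 'I_3).
Local Notation i1 := (inord 1 : 'I_3).
Local Notation i2 := (inord 2 : 'I_3).
Local Notation o1 := (oone R).

Variable G : albert R -> albert R -> albert R -> R.
Hypothesis GD : forall x x' y z, G (x + x') y z = G x y z + G x' y z.
Hypothesis GZ : forall r x y z, G (r *: x) y z = r * G x y z.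
Hypothesis G12 : forall x y z, G x y z = G y x z.
Hypothesis G23 : forall x y z, G x y z = G x z y.
Hypothesis Ginv : forall g, isometric_aut g -> forall x y z, G (g x) (g y) (g z) = G x y z.

Lemma G13 x y z : G x y z = G z y x.
Proof. by rewrite G12 G23 G12. Qed.
Lemma GD2 x y y' z : G x (y + y') z = G x y z + G x y' z.
Proof. by rewrite G12 GD !(G12 x). Qed.
Lemma GD3 x y z z' : G x y (z + z') = G x y z + G x y z'.
Proof. by rewrite G13 GD !(G13 _ y x). Qed.
Lemma GZ2 r x y z : G x (r *: y) z = r * G x y z.
Proof. by rewrite G12 GZ (G12 x). Qed.
Lemma GZ3 r x y z : G x y (r *: z) = r * G x y z.
Proof. by rewrite G13 GZ (G13 _ y x). Qed.

Definition osym (e : octonion R -> octonion R) :=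
  oct_involution e /\ e o1 = o1.

Lemma Gsign i x y z : G (sign_mx i x) (sign_mx i y) (sign_mx i z) = G x y z.
Proof. exact/Ginv/sign_isom. Qed.

Lemma ord3_other (i : 'I_3) : exists j, j != i.
Proof. by elim/ord3_ind: i; [exists i1|exists i0|exists i0]; rewrite ord3_eq. Qed.

(** A value that changes sign under some [sign_mx l] is zero. Here and in the next two lemmas [l] is
    chosen so that an odd number of arguments is negated. *)
Lemma G_EEF i j k a : G (E i) (E j) (F k a) = 0.
Proof.
have [l hl] := ord3_other k.
have := Gsign l (E i) (E j) (F k a); rewrite !sign_diag sign_off (negbTE hl) GZ3; lra.
Qed.

Lemma G_EFF i j k a b : j != k -> G (E i) (F j a) (F k b) = 0.
Proof.
move=> hjk.
have := Gsign j (E i) (F j a) (F k b).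
rewrite !sign_diag !sign_off eqxx (negbTE hjk) GZ3 GZ2; lra.
Qed.

Lemma G_FFF i k a b c : G (F i a) (F i b) (F k c) = 0.
Proof.
have [l hl] := ord3_other k.
have := Gsign l (F i a) (F i b) (F k c); rewrite !sign_off (negbTE hl) GZ GZ2 GZ3.
case: ifP => _; lra.
Qed.

Lemma osym1 : osym (@osign1 R).
Proof. split; [exact: osign1_inv|]. rewrite /osign1 /o1 /oreal_mx /=;
  apply: octonion_eq => /=; split; split; rewrite ?oppr0 //. Qed.
Lemma osym2 : osym (@osign2 R).
Proof. split; [exact: osign2_inv|]. rewrite /osign2 /o1 /oreal_mx /=;
  apply: octonion_eq => /=; split; split; rewrite ?oppr0 //. Qed.
Lemma osym3 : osym (@osign3 R).
Proof. split; [exact: osign3_inv|]. rewrite /osign3 /o1 /oreal_mx /=;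
  apply: octonion_eq => /=; split; split; rewrite ?oppr0 //. Qed.

Lemma osym0 e : osym e -> e 0 = 0.
Proof. by move=> [[/linear_morphisms [_ e0 _] _ _ _ _] _]. Qed.

Lemma linear_real_part (L : octonion R -> R) :
  (forall a b, L (a + b) = L a + L b) -> (forall r a, L (r *: a) = r * L a) ->
  (forall e, osym e -> forall a, L (e a) = L a) -> forall a, L a = oreal a * L o1.
Proof.
move=> LD LZ Le; apply: linear_osign_fixed => //; apply: Le.
- exact: osym1.
- exact: osym2.
- exact: osym3.
Qed.

Lemma linear_unit0 (L : octonion R -> R) : (forall r a, L (r *: a) = r * L a) ->
  (forall u, odot u u = 1 -> L u = 0) -> forall a, L a = 0.
Proof.
by move=> LZ Lu a; have [r [u [hu ->]]] := octonion_normalize a; rewrite LZ Lu ?mulr0.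
Qed.

Lemma Gosym e x y z : osym e -> G (entry_mx e x) (entry_mx e y) (entry_mx e z) = G x y z.
Proof. by move=> [he _]; apply: Ginv; apply: entry_isom. Qed.

Lemma Glmul u x y z : odot u u = 1 -> G (lmul_mx u x) (lmul_mx u y) (lmul_mx u z) = G x y z.
Proof. by move=> hu; apply: Ginv; apply: lmul_isom. Qed.

Lemma Gcycle x y z : G (cycle_mx x) (cycle_mx y) (cycle_mx z) = G x y z.
Proof. by apply: Ginv; apply: cycle_isom. Qed.

Lemma Gswap x y z : G (swap_mx x) (swap_mx y) (swap_mx z) = G x y z.
Proof. by apply: Ginv; apply: swap_isom. Qed.

(** On block 0 the map [lmul_mx u] is left multiplication by [oconj u], which carries the unit [u]
    to 1. What remains is linear in one octonion, and the sign involutions reduce it to its real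
    part. *)
Lemma G_EFF_unit i u b : odot u u = 1 ->
  G (E i) (F i0 u) (F i0 b) = G (E i) (F i0 o1) (F i0 (omul (oconj u) b)).
Proof.
move=> hu; rewrite -(Glmul _ _ _ hu) lmul_diag !lmul_off omul_oconj hu.
by [].
Qed.

Lemma G_EFF_real i b :
  G (E i) (F i0 o1) (F i0 b) = oreal b * G (E i) (F i0 o1) (F i0 o1).
Proof.
apply: (@linear_real_part (fun b => G (E i) (F i0 o1) (F i0 b))).
- by move=> a c; rewrite offdiagD GD3.
- by move=> r a; rewrite offdiagZ GZ3.
move=> e he a; rewrite -[RHS](Gosym _ _ _ he) !(entry_diag _ (osym0 he)) !(entry_off _ _
  (osym0 he)).
by rewrite he.2.
Qed.

Lemma G_EFF_norm i u : odot u u = 1 ->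
  G (E i) (F i0 u) (F i0 u) = G (E i) (F i0 o1) (F i0 o1).
Proof. by move=> hu; rewrite G_EFF_unit // omul_oconj hu. Qed.

Lemma G_EFF_eq0 i : G (E i) (F i0 o1) (F i0 o1) = 0 ->
  forall a b, G (E i) (F i0 a) (F i0 b) = 0.
Proof.
move=> h a b; move: a; apply: linear_unit0 => [r a|u hu].
  by rewrite offdiagZ GZ2.
by rewrite G_EFF_unit // G_EFF_real h mulr0.
Qed.

Local Notation t a b c := (G (F i0 a) (F i1 b) (F i2 c)).

Lemma t_lmul u a b c : odot u u = 1 ->
  t (omul (oconj u) a) (omul b (oconj u)) (omul (omul u c) u) = t a b c.
Proof. by move=> hu; rewrite -[RHS](Glmul _ _ _ hu) !lmul_off. Qed.

Lemma t_cycle a b c : t a b c = t b c a.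
Proof. by rewrite -[LHS]Gcycle !cycle_off G12 G23. Qed.

Lemma t_lmul' u a b c : odot u u = 1 ->
  t (omul (omul u a) u) (omul (oconj u) b) (omul c (oconj u)) = t a b c.
Proof. by move=> hu; rewrite t_cycle t_lmul // -t_cycle. Qed.

(** The triality action of unit octonions moves the first slot to 1, then the second slot while the
    first stays real; the third slot then only counts through its real part. *)
Lemma t_eq0 : t o1 o1 o1 = 0 -> forall a b c, t a b c = 0.
Proof.
move=> h.
have h1 c : t o1 o1 c = 0.
  rewrite (@linear_real_part (fun c => t o1 o1 c)) ?h ?mulr0 //.
  - by move=> a d; rewrite offdiagD GD3.
  - by move=> r a; rewrite offdiagZ GZ3.
  by move=> e he a; rewrite -[RHS](Gosym _ _ _ he) !(entry_off _ _ (osym0 he)) he.2.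
(* An imaginary unit squares to -1, so [t_lmul'] carries the slots (1, u, c) to (-1, 1, omul c
   (oconj u)). *)
have h2 u c : odot u u = 1 -> oreal u = 0 -> t o1 u c = 0.
  move=> hu hu0; rewrite -(t_lmul' _ _ _ hu) omul_oconj hu.
  have -> : omul (omul u o1) u = - o1.
    have hu' : u = - oconj u by rewrite oconj_imag // opprK.
    by rewrite omulo_one {1}hu' omulNl omul_oconj hu.
  by rewrite offdiagN -scaleN1r GZ h1 mulr0.
have h3 b c : t o1 b c = 0.
  have [eb hb] := oreal_split b; move: eb hb; set b' := b - _ => eb hb.
  have [r [u [hu e]]] := octonion_normalize b'.
  rewrite eb offdiagD GD2 !offdiagZ GZ2 h1 mulr0 add0r e offdiagZ GZ2.
  have [->|r0] := eqVneq r 0; first by rewrite mul0r.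
  have hu0 : oreal u = 0.
    by move/eqP: hb; rewrite e orealZ mulf_eq0 (negbTE r0) => /eqP.
  by rewrite h2 ?mulr0.
move=> a b c; move: a; apply: linear_unit0 => [r a|u hu].
  by rewrite offdiagZ GZ.
by rewrite -(t_lmul _ _ _ hu) omul_oconj hu h3.
Qed.

Hypothesis G1 : G (jone R) (jone R) (jone R) = 0.
(** The trace of the minor relation on [G]: a point p has T(p, E i0) T(p, E i1) = xi1 xi2, whereas
    the squares of T(p, F i2 u) = 2 [odot (off3 p) u] add up to four times the norm of [off3 p]. *)
Hypothesis Grel : forall x,
  4 * G x (E i0) (E i1) = \sum_(u <- obasis R) G x (F i2 u) (F i2 u).

(* Up to symmetry seven values of [G] are left. The rotation gives three linear
   relations between them, [Grel] two and [G1] one; two values agree by [swap_mx]. *)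
Lemma G_scalars_eq0 :
  [/\ G (E i0) (E i0) (E i0) = 0, G (E i0) (E i0) (E i1) = 0, G (E i0) (E i1) (E i2) = 0 &
   [/\ G (E i0) (F i0 o1) (F i0 o1) = 0, G (E i1) (F i0 o1) (F i0 o1) = 0,
      G (E i2) (F i0 o1) (F i0 o1) = 0 & G (F i0 o1) (F i1 o1) (F i2 o1) = 0]].
Proof.
have [rE0 rE2 rF] := rot_block R.
have Grot x y z : G (rot_mx 1 x) (rot_mx 1 y) (rot_mx 1 z) = G x y z.
  by apply: Ginv; apply: rot_isom.
have hA1 : G (E i1) (E i1) (E i1) = G (E i0) (E i0) (E i0).
  by rewrite -[LHS]Gcycle !cycle_diag.
have hA2 : G (E i2) (E i2) (E i2) = G (E i0) (E i0) (E i0).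
  by rewrite -[LHS]Gcycle !cycle_diag.
have hB110 : G (E i1) (E i1) (E i0) = G (E i0) (E i0) (E i1).
  by rewrite -[LHS]Gswap !swap_diag.
have hB002 : G (E i0) (E i0) (E i2) = G (E i0) (E i0) (E i1).
  by rewrite -hB110 -[RHS]Gcycle !cycle_diag.
have hB112 : G (E i1) (E i1) (E i2) = G (E i0) (E i0) (E i1).
  by rewrite -[LHS]Gcycle !cycle_diag.
have hB220 : G (E i2) (E i2) (E i0) = G (E i0) (E i0) (E i1).
  by rewrite -[LHS]Gcycle !cycle_diag hB112.
have hB221 : G (E i2) (E i2) (E i1) = G (E i0) (E i0) (E i1).
  by rewrite -[LHS]Gcycle !cycle_diag hB110.
have hr a b : G (E i0) (F i2 a) (F i2 b) = G (E i2) (F i1 a) (F i1 b).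
  by rewrite -[LHS]Gcycle cycle_diag !cycle_off.
have hr' a b : G (E i2) (F i1 a) (F i1 b) = G (E i1) (F i0 a) (F i0 b).
  by rewrite -[LHS]Gcycle cycle_diag !cycle_off.
have hs a b : G (E i1) (F i1 a) (F i1 b) = G (E i0) (F i0 a) (F i0 b).
  by rewrite -[LHS]Gcycle cycle_diag !cycle_off.
have hs' a b : G (E i2) (F i2 a) (F i2 b) = G (E i1) (F i1 a) (F i1 b).
  by rewrite -[LHS]Gcycle cycle_diag !cycle_off.
have hq a b : G (E i0) (F i1 a) (F i1 b) = G (E i2) (F i0 a) (F i0 b).
  by rewrite -[LHS]Gcycle cycle_diag !cycle_off.
have hq' a b : G (E i1) (F i2 a) (F i2 b) = G (E i0) (F i1 a) (F i1 b).
  by rewrite -[LHS]Gcycle cycle_diag !cycle_off.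
have hrq : G (E i1) (F i2 o1) (F i2 o1) = G (E i0) (F i2 o1) (F i2 o1).
  by rewrite -[LHS]Gswap swap_diag !swap_off oconj_oone.
have sum8 (f : octonion R -> R) k : (forall u, odot u u = 1 -> f u = k) ->
    \sum_(u <- obasis R) f u = 8 * k.
  move=> hf; rewrite (eq_big_seq (fun=> k)); last by move=> u /obasis_unit /hf.
  by rewrite !big_cons big_nil; ring.
have e1 : 4 * G (E i0) (E i0) (E i1) = 8 * G (E i1) (F i0 o1) (F i0 o1).
  by rewrite Grel; apply: sum8 => u hu; rewrite hr hr' G_EFF_norm.
have e2 : 4 * G (E i2) (E i0) (E i1) = 8 * G (E i0) (F i0 o1) (F i0 o1).
  by rewrite Grel; apply: sum8 => u hu; rewrite hs' hs G_EFF_norm.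
have n01 : i0 != i1 by rewrite ord3_eq.
have n10 : i1 != i0 by rewrite ord3_eq.
have e3 := Grot (E i0) (E i0) (E i2).
have e4 := Grot (E i0) (E i0) (E i0).
have e5 := Grot (E i0) (F i0 o1) (F i0 o1).
set A := G (E i0) (E i0) (E i0) in hA1 hA2 e4 *.
set B := G (E i0) (E i0) (E i1) in hB110 hB002 hB112 hB220 hB221 e1 *.
set C := G (E i0) (E i1) (E i2) in e2 *.
set s := G (E i0) (F i0 o1) (F i0 o1) in e2 e5 *.
set r := G (E i1) (F i0 o1) (F i0 o1) in e1 *.
set t := G (F i0 o1) (F i1 o1) (F i2 o1).
(* By symmetry and the permutations of the coordinates, a value on three diagonal idempotents
   depends only on which indices coincide. *)
have vE i j k : G (E i) (E j) (E k) =
    if i == j then (if j == k then A else B) else if (i == k) || (j == k) then B else C.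
  have hBs := (hB110, hB002, hB112, hB220, hB221).
  elim/ord3_ind: i; elim/ord3_ind: j; elim/ord3_ind: k; rewrite ?blockE /= ?hA1 ?hA2 //;
  by first [ done | by rewrite ?hBs | by rewrite G12 ?hBs | by rewrite G23 ?hBs
    | by rewrite G13 ?hBs | by rewrite G12 G23 ?hBs | by rewrite G23 G12 ?hBs ].
have z1 i j k : G (E i) (F k o1) (E j) = 0 by rewrite G23 G_EEF.
have z2 i j k : G (F k o1) (E i) (E j) = 0 by rewrite G12 z1.
have z3 i : G (F i o1) (F i o1) (F i o1) = 0 by rewrite G_FFF.
have f1 i j k : G (F j o1) (E i) (F k o1) = G (E i) (F j o1) (F k o1) by rewrite G12.
have f2 i j k : G (F j o1) (F k o1) (E i) = G (E i) (F j o1) (F k o1) by rewrite G13 G23.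
have g1 : G (E i0) (F i1 o1) (F i1 o1) = r by rewrite -hq' hrq hr hr'.
have g2 : G (E i2) (F i0 o1) (F i0 o1) = r by rewrite -hq.
have g3 : G (E i0) (F i2 o1) (F i2 o1) = r by rewrite hr hr'.
have g4 : G (E i1) (F i2 o1) (F i2 o1) = r by rewrite hrq.
have g5 : G (E i2) (F i2 o1) (F i2 o1) = s by rewrite hs' hs.
have g6 : G (E i1) (F i1 o1) (F i1 o1) = s by rewrite hs.
have g7 : G (F i2 o1) (F i0 o1) (F i0 o1) = 0 by rewrite G13 G_FFF.
have g8 : G (F i2 o1) (F i1 o1) (F i1 o1) = 0 by rewrite G13 G_FFF.
have g9 : G (F i2 o1) (F i0 o1) (F i1 o1) = t by rewrite G12 G23.
have g10 : G (F i2 o1) (F i1 o1) (F i0 o1) = t by rewrite G13.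
have exp1 := (GD, GZ); have exp2 := (GD2, GZ2); have exp3 := (GD3, GZ3).
move: G1; rewrite jone_decomp !exp1 !exp2 !exp3 !vE !ord3_eq !eqxx /= => e0.
move: e3; rewrite rE0 rE2 !exp1 !exp2 !vE !ord3_eq !eqxx /= !z1 !z2 !f2 g5 => {}e3.
move: e4; rewrite rE0 !exp1 !exp2 !exp3 !vE !ord3_eq !eqxx /=.
rewrite !G_EEF !z1 !z2 !z3 !f1 !f2 g3 g4 => {}e4.
move: e5; rewrite rE0 rF !exp1 !exp2 !exp3 !(G_EFF _ _ _ n01) !(G_EFF _ _ _ n10).
rewrite g6 g7 g8 g9 g10 g1 -/s -/r => {}e5.
move: e2; rewrite vE !ord3_eq /= g2 => {}e2.
move: e0 e2 e3 e4 e5.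
clearbody A B C s r t; move: e1; clear.
(* Cleared of denominators, the rotation relations read 2 B = 2 C + s, A = B + r and t = r - s.
   Together with B = 2 r, C = 2 s and 3 A + 18 B + 6 C = 0 they leave only the zero solution. *)
by move=> *; do ?split; lra.
Qed.

Lemma G_EEE_eq0 i j k : G (E i) (E j) (E k) = 0.
Proof.
have [hA hB hC _] := G_scalars_eq0.
have hB' : G (E i1) (E i1) (E i0) = 0 by rewrite -[LHS]Gswap !swap_diag hB.
elim/ord3_ind: i; elim/ord3_ind: j; elim/ord3_ind: k;
  do 3?[by rewrite ?(G12 (E i1) (E i0)) ?(G12 (E i2) (E i0)) ?(G12 (E i2) (E i1))
    ?(G23 _ (E i1) (E i0)) ?(G23 _ (E i2) (E i0)) ?(G23 _ (E i2) (E i1))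
    ?(G12 (E i1) (E i0)) ?(G12 (E i2) (E i0)) ?(G12 (E i2) (E i1)) ?hA ?hB ?hC ?(G13 _ _ (E
      i1)) ?hB'
    | rewrite -[LHS]Gcycle !cycle_diag].
Qed.

Lemma G_EFF_vanish i j k a b : G (E i) (F j a) (F k b) = 0.
Proof.
have [_ _ _ [h0 h1 h2 _]] := G_scalars_eq0.
have h l c d : G (E l) (F i0 c) (F i0 d) = 0.
  by elim/ord3_ind: l; apply: G_EFF_eq0.
have [<-|/G_EFF -> //] := eqVneq j k.
elim/ord3_ind: j; first exact: h.
  by rewrite -[LHS]Gcycle !cycle_off; elim/ord3_ind: i; rewrite cycle_diag h.
by rewrite -[LHS]Gcycle -[LHS]Gcycle !cycle_off; elim/ord3_ind: i; rewrite !cycle_diag h.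
Qed.

Lemma G_FFF_eq0 i j k a b c : G (F i a) (F j b) (F k c) = 0.
Proof.
have [_ _ _ [_ _ _ ht]] := G_scalars_eq0; have {}ht := t_eq0 ht.
have [->|ij] := eqVneq i j; first exact: G_FFF.
have [->|ik] := eqVneq i k; first by rewrite G23 G_FFF.
have [->|jk] := eqVneq j k; first by rewrite G13 G_FFF.
move: ij ik jk; elim/ord3_ind: i; elim/ord3_ind: j; elim/ord3_ind: k;
  rewrite ?blockE //= => _ _ _.
all: by first [rewrite ht | rewrite G12 ht | rewrite G23 ht | rewrite G13 ht
  | rewrite G12 G23 ht | rewrite G23 G12 ht].
Qed.

Lemma albert_block_ind (P : albert R -> Prop) :
  (forall x y, P x -> P y -> P (x + y)) -> (forall r x, P x -> P (r *: x)) ->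
  (forall i, P (E i)) -> (forall i a, P (F i a)) -> forall x, P x.
Proof.
move=> PD PZ PE PF x; case: (herm3_surj x) => r1 [r2 [r3 [a [b [c ->]]]]].
by rewrite block_decomp; do 5?apply: (PD); try exact: PF; apply: PZ; exact: PE.
Qed.

Lemma invariant_trilinear_eq0 x y z : G x y z = 0.
Proof.
move: x; apply: albert_block_ind => [x x' hx hx'|r x hx|i|i a];
  rewrite ?GD ?GZ ?hx ?hx' ?addr0 ?mulr0 //.
all: move: y; apply: albert_block_ind => [y y' hy hy'|r y hy|j|j b];
  rewrite ?GD2 ?GZ2 ?hy ?hy' ?addr0 ?mulr0 //.
all: move: z; apply: albert_block_ind => [z z' hz hz'|r z hz|k|k c];
  rewrite ?GD3 ?GZ3 ?hz ?hz' ?addr0 ?mulr0 //.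
- exact: G_EEE_eq0.
- exact: G_EEF.
- by rewrite G23 G_EEF.
- exact: G_EFF_vanish.
- by rewrite G13 G_EEF.
- by rewrite G12 G_EFF_vanish.
- by rewrite G13 G_EFF_vanish.
- exact: G_FFF_eq0.
Qed.

End Invariant.

Transparent omul oconj odot oreal.

(** * Continuity of the coordinates and an orthogonal basis of J *)

Section Continuity.
Variable R : realType.
Implicit Types (r s t : R) (a b c u : octonion R) (x y z p q : albert R).

Lemma mx_entry_continuous (T : topologicalType) m n i j :
  continuous (fun M : 'M[T]_(m, n) => M i j).
Proof.
move=> M A /= MA; exists (fun k l => if (k == i) && (l == j) then A else setT).
  move=> k l; case: ifP => [/andP[/eqP-> /eqP->] //|_]; exact: filterT.
by move=> N /(_ i j); rewrite !eqxx.
Qed.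

Lemma mx_continuousP (S T : topologicalType) m n (f : S -> 'M[T]_(m, n)) :
  (forall i j, continuous (fun w : S => f w i j)) -> continuous f.
Proof.
move=> cf w A /= [P fP PA].
have := @filter_forall S ('I_m * 'I_n)%type (fun ij v => P ij.1 ij.2 (f v ij.1 ij.2)) (nbhs
  w) (nbhs_filter w).
move=> /(_ (fun ij => cf ij.1 ij.2 w _ (fP ij.1 ij.2))).
by apply: filterS => v hv; apply: PA => i j; exact: (hv (i, j)).
Qed.

(** A retraction of all matrices onto J. The open sets of J are induced by those of the matrix
    space, so continuity of a function composed with this retraction supplies the open sets of
    matrices that [albert_open] asks for. *)
Definition mx_coord (M : 'M[octonion R]_3) : albert R :=
  herm3 (oreal (M ord0 ord0)) (oreal (M (inord 1) (inord 1))) (oreal (M (inord 2) (inord 2)))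
     (M (inord 1) (inord 2)) (M (inord 2) ord0) (M ord0 (inord 1)).

Lemma mx_coordK x : mx_coord (albert_mx x) = x.
Proof. exact: herm3K. Qed.

Lemma continuous_fst (S T U : topologicalType) (f : S -> T * U) :
  continuous f -> continuous (fun w => (f w).1).
Proof. by move=> cf w; apply: (@continuous_comp _ _ _ f fst); [exact: cf|exact: cvg_fst]. Qed.

Lemma continuous_snd (S T U : topologicalType) (f : S -> T * U) :
  continuous f -> continuous (fun w => (f w).2).
Proof. by move=> cf w; apply: (@continuous_comp _ _ _ f snd); [exact: cf|exact: cvg_snd]. Qed.

Lemma odot_continuous (S : topologicalType) (f : S -> octonion R) b :
  continuous f -> continuous (fun w => odot (f w) b).
Proof.
move=> cf; have c1 := continuous_fst cf; have c2 := continuous_snd cf.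
have c11 := continuous_fst c1; have c12 := continuous_snd c1.
have c21 := continuous_fst c2; have c22 := continuous_snd c2.
have h : (fun w => odot (f w) b) = (fun w =>
   (f w).1.1.1 * b.1.1.1 + (f w).1.1.2 * b.1.1.2 +
   ((f w).1.2.1 * b.1.2.1 + (f w).1.2.2 * b.1.2.2) +
   ((f w).2.1.1 * b.2.1.1 + (f w).2.1.2 * b.2.1.2 +
   ((f w).2.2.1 * b.2.2.1 + (f w).2.2.2 * b.2.2.2))).
  by apply: funext => w; octcase (f w); octcase b; rewrite /odot /oreal /=; ring.
rewrite h => w.
do 3?[apply: cvgD]; apply: cvgM; try exact: cvg_cst.
all: first [exact: (continuous_fst c11) | exact: (continuous_snd c11)
 | exact: (continuous_fst c12) | exact: (continuous_snd c12)
 | exact: (continuous_fst c21) | exact: (continuous_snd c21)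
 | exact: (continuous_fst c22) | exact: (continuous_snd c22)].
Qed.

Lemma oreal_odot a : oreal a = odot a (oone R).
Proof. by octcase a; rewrite /odot /oreal /=; ring. Qed.

Lemma continuous_add (S : topologicalType) (f g : S -> R) :
  continuous f -> continuous g -> continuous (fun w => f w + g w).
Proof. by move=> cf cg w; apply: cvgD; [exact: cf|exact: cg]. Qed.

Lemma continuous_mulr (S : topologicalType) (f : S -> R) r :
  continuous f -> continuous (fun w => f w * r).
Proof. by move=> cf w; apply: cvgM; [exact: cf|exact: cvg_cst]. Qed.

Lemma trace_form_continuous y : continuous (fun M => trace_form (mx_coord M) y).
Proof.
case: (herm3_surj y) => r1 [r2 [r3 [a1 [a2 [a3 ->]]]]].
have c i j b : continuous (fun M : 'M[octonion R]_3 => odot (M i j) b).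
  exact/odot_continuous/mx_entry_continuous.
rewrite (_ : (fun M => _) = (fun M : 'M[octonion R]_3 =>
  odot (M ord0 ord0) (oone R) * r1 + odot (M (inord 1) (inord 1)) (oone R) * r2 +
  odot (M (inord 2) (inord 2)) (oone R) * r3 +
  (odot (M (inord 1) (inord 2)) a1 + odot (M (inord 2) ord0) a2 + odot (M ord0 (inord 1)) a3)
    * 2)).
  apply: continuous_add; last first.
    apply: continuous_mulr; apply: continuous_add; last exact: c.
    by apply: continuous_add; exact: c.
  apply: continuous_add; last by apply: continuous_mulr; exact: c.
  by apply: continuous_add; apply: continuous_mulr; exact: c.
by apply: funext => M; rewrite herm3_trace_form !oreal_odot [2 * _]mulrC.
Qed.

Definition albert_basis : seq (albert R) :=
  [seq @diag_unit R i | i <- [:: ord0; inord 1; inord 2]] ++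
  [seq offdiag i u | i <- [:: ord0; inord 1; inord 2], u <- obasis R].

Lemma obasis_decomp a : a = \sum_(u <- obasis R) odot a u *: u.
Proof.
rewrite !big_cons big_nil; octcase a.
by apply: octonion_eq; split; split; rewrite /odot /oreal /= /GRing.scale /=; ring.
Qed.

Lemma offdiag_sum i (s : seq (octonion R)) (f : octonion R -> octonion R) :
  offdiag i (\sum_(u <- s) f u) = \sum_(u <- s) offdiag i (f u).
Proof.
elim: s => [|u s IH]; last by rewrite !big_cons offdiagD IH.
by rewrite !big_nil -(scale0r 0) offdiagZ scale0r.
Qed.

Lemma trace_form_off i x a : trace_form x (offdiag i a) =
  2 * odot (if i == ord0 then off1 x else if i == inord 1 then off2 x else off3 x) a.
Proof.
have z b : odot b 0 = 0 by exact: odot0.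
case: (herm3_surj x) => r1 [r2 [r3 [a1 [a2 [a3 ->]]]]]; rewrite herm3_trace_form !coordE.
by elim/ord3_ind: i; rewrite !ord3_eq ?eqxx /= !z; ring.
Qed.

Lemma trace_form_diag i x : trace_form x (diag_unit R i) =
  if i == ord0 then xi1 x else if i == inord 1 then xi2 x else xi3 x.
Proof.
have z b : odot b 0 = 0 by exact: odot0.
case: (herm3_surj x) => r1 [r2 [r3 [a1 [a2 [a3 ->]]]]]; rewrite herm3_trace_form !coordE.
by elim/ord3_ind: i; rewrite !ord3_eq ?eqxx /= !z; ring.
Qed.

(** The basis is orthogonal but not orthonormal: its off-diagonal members have T(b, b) = 2, hence
    the divisors. *)
Lemma albert_basis_decomp x :
  x = \sum_(b <- albert_basis) (trace_form x b / trace_form b b) *: b.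
Proof.
have hd i : (trace_form x (diag_unit R i) / trace_form (diag_unit R i) (diag_unit R i)) *:
  diag_unit R i
   = trace_form x (diag_unit R i) *: diag_unit R i.
  rewrite [trace_form (diag_unit R i) _]trace_form_diag !coordE.
  by elim/ord3_ind: i; rewrite ?ord3_eq ?eqxx /= divr1.
have ho i : \sum_(u <- obasis R) (trace_form x (offdiag i u) / trace_form (offdiag i u)
  (offdiag i u)) *: offdiag i u
   = offdiag i (if i == ord0 then off1 x else if i == inord 1 then off2 x else off3 x).
  rewrite [in RHS](obasis_decomp (if _ then _ else _)) offdiag_sum;
    apply: eq_big_seq => u /obasis_unit hu.
  rewrite !trace_form_off offdiagZ; congr (_ *: _).
  by elim/ord3_ind: i; rewrite !coordE ?ord3_eq ?eqxx /= hu; field.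
rewrite /albert_basis big_cat big_map big_allpairs_dep /=.
rewrite (eq_bigr _ (fun i _ => hd i)) (eq_bigr _ (fun i _ => ho i)) !big_cons !big_nil.
by rewrite !trace_form_diag !ord3_eq !eqxx /= -[LHS]herm3K block_decomp !addr0 !addrA.
Qed.
End Continuity.

Opaque omul oconj odot oreal.

(** * Borel measurability of linear maps and of the equations of the Cayley plane *)

Section Measurability.
Variable R : realType.
Implicit Types (r s t : R) (a b c u : octonion R) (x y z p q : albert R).

Lemma trace_form_measurable y :
  measurable_fun setT (fun x : borel_albert R => trace_form x y).
Proof.
apply: (measurability _ (RGenOpens.measurableE R)).
move=> _ [_ [a [b ->] <-]]; rewrite setTI; apply: sub_sigma_algebra.
exists ((fun M => trace_form (mx_coord M) y) @^-1` `]a, b[%classic) => /=.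
  by have /continuousP := @trace_form_continuous R y; apply; exact: interval_open.
by apply/seteqP; split=> x /=; rewrite mx_coordK.
Qed.

Lemma continuous_oadd (S : topologicalType) (f g : S -> octonion R) :
  continuous f -> continuous g -> continuous (fun w => f w + g w).
Proof. by move=> cf cg w; apply: cvgD; [exact: cf|exact: cg]. Qed.

Lemma continuous_oscale (S : topologicalType) (f : S -> R) a :
  continuous f -> continuous (fun w => f w *: a).
Proof. by move=> cf w; apply: cvgZr_tmp; exact: cf. Qed.

Lemma linear_continuous_mx (g : albert R -> albert R) : linear g ->
  continuous (fun M => albert_mx (g (mx_coord M))).
Proof.
move=> gl; apply: mx_continuousP => i j.
have [gD g0 gZ] := linear_morphisms gl.
pose f M (b : albert R) := (trace_form (mx_coord M) b / trace_form b b) *: albert_mx (g b) i j.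
rewrite (_ : (fun M => _) = (fun M => \sum_(b <- albert_basis R) f M b)); last first.
  apply: funext => M; rewrite [in LHS](albert_basis_decomp (mx_coord M)) /f.
  elim: (albert_basis R) => [|b s IH]; first by rewrite !big_nil g0 mxE.
  by rewrite !big_cons gD gZ /= !mxE IH.
elim: (albert_basis R) => [|b s IH].
  rewrite (_ : (fun M => _) = (fun=> 0)); first exact: cst_continuous.
  by apply: funext => M; rewrite big_nil.
rewrite (_ : (fun M => _) = (fun M => f M b + \sum_(b <- s) f M b)); last first.
  by apply: funext => M; rewrite big_cons.
apply: continuous_oadd; last exact: IH.
apply: (@continuous_oscale _ (fun M => trace_form (mx_coord M) b / trace_form b b)).
by apply: continuous_mulr; exact: trace_form_continuous.
Qed.

Lemma linear_measurable (g : albert R -> albert R) : linear g ->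
  measurable_fun setT (g : borel_albert R -> borel_albert R).
Proof.
move=> gl; apply: (@measurability _ _ (borel_albert R) (borel_albert R) setT g (@albert_open
  R) erefl).
move=> _ [_ [U oU <-] <-]; rewrite setTI; apply: sub_sigma_algebra.
exists ((fun M => albert_mx (g (mx_coord M))) @^-1` U).
  by have /continuousP := linear_continuous_mx gl; apply.
by apply/seteqP; split=> x /=; rewrite mx_coordK.
Qed.
Lemma trace_form_basis0 x : (forall y, y \in albert_basis R -> trace_form x y = 0) -> x = 0.
Proof.
move=> h; rewrite (albert_basis_decomp x) big1_seq // => b /andP[_ hb].
by rewrite h // mul0r scale0r.
Qed.

(** Expanding both factors in the basis gives a quadratic polynomial in the measurable coordinates
    of [x]. *)
Lemma trace_form_jordan_measurable y :
  measurable_fun setT (fun x : borel_albert R => trace_form (jordan x x) y).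
Proof.
pose k (x b : albert R) : R := trace_form x b / trace_form b b.
have mkb (b : albert R) : measurable_fun setT (fun x : borel_albert R => k x b).
  by apply: measurable_funM; [exact: trace_form_measurable|exact: measurable_cst].
have TS (s : seq (albert R)) (f : albert R -> R) z :
    trace_form (\sum_(b <- s) f b *: b) z = \sum_(b <- s) f b * trace_form b z.
  elim: s => [|b s IH]; first by rewrite !big_nil -(scale0r 0) trace_formZl mul0r.
  by rewrite !big_cons trace_formDl trace_formZl IH.
rewrite (_ : (fun x => _) = (fun x : borel_albert R => \sum_(b <- albert_basis R)
   k x b * \sum_(d <- albert_basis R) k x d * trace_form d (jordan b y))).
  apply: measurable_sum => b; apply: measurable_funM => //.
  by apply: measurable_sum => d; apply: measurable_funM.
apply: funext => x.
rewrite trace_form_assoc {1}(albert_basis_decomp x) TS; apply: eq_bigr => b _.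
congr (_ * _); by rewrite -trace_form_assoc (jordanC b) trace_form_assoc
  {1}(albert_basis_decomp x) TS.
Qed.

Lemma albert_tr_measurable : measurable_fun setT (fun x : borel_albert R => albert_tr x).
Proof.
rewrite (_ : (fun x => _) = (fun x : borel_albert R => trace_form x (jone R))).
  exact: trace_form_measurable.
by apply: funext => x; rewrite trace_form1.
Qed.

Lemma idempotent_trace_measurable :
  measurable [set x : borel_albert R | jordan x x = x /\ albert_tr x = 1].
Proof.
(* A sum of squares of the coordinates of [jordan x x - x], up to positive factors; its zero set is
   the set of idempotents. *)
pose f (x : borel_albert R) : R := \sum_(b <- albert_basis R)
  (trace_form (jordan x x) b - trace_form x b) ^+ 2.
have mf : measurable_fun setT f.
  apply: measurable_sum => b; apply: measurable_funX; apply: measurable_funB.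
    exact: trace_form_jordan_measurable.
  exact: trace_form_measurable.
rewrite (_ : [set x | _] = (f @^-1` [set 0]) `&` ((fun x : borel_albert R => albert_tr x)
  @^-1` [set 1])).
  apply: measurableI; rewrite -[X in measurable X]setTI.
    by apply: mf => //; exact: measurable_set1.
  by apply: albert_tr_measurable => //; exact: measurable_set1.
apply/seteqP; split=> x /= [h ->]; split=> //.
  by rewrite /f h; rewrite big1 // => b _; rewrite subrr expr0n.
have fb (b : albert R) : b \in albert_basis R -> trace_form (jordan x x) b = trace_form x b.
  move=> hb; move/eqP: h; rewrite /f psumr_eq0 => [/allP /(_ b hb)|d _]; last exact: sqr_ge0.
  by rewrite /= sqrf_eq0 subr_eq0 => /eqP.
apply/eqP; rewrite -subr_eq0; apply/eqP; apply: trace_form_basis0 => b hb.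
by rewrite -scaleN1r trace_formDl trace_formZl fb // mulN1r subrr.
Qed.

End Measurability.

(** * Idempotents of trace 1, and invariance of the integral over the Cayley plane *)

Section CayleyPlane.
Variable R : realType.
Implicit Types (r s t : R) (a b c u : octonion R) (x y z p q : albert R).

(** The off-diagonal equations say that the conjugate of a product of two entries is a real multiple
    of the third. Taking norms, which are multiplicative, leaves a system in six real unknowns. *)
Lemma idempotent_coord r1 r2 r3 a b c (p := herm3 r1 r2 r3 a b c) : jordan p p = p ->
  let A := odot a a in let B := odot b b in let C := odot c c in
  [/\ r1 ^+ 2 + B + C = r1, r2 ^+ 2 + C + A = r2, r3 ^+ 2 + A + B = r3 &
   [/\ B * C = (1 - r2 - r3) ^+ 2 * A, C * A = (1 - r3 - r1) ^+ 2 * B &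
       A * B = (1 - r1 - r2) ^+ 2 * C]].
Proof.
rewrite /p herm3_jordan => h.
have h1 := congr1 (@xi1 R) h; have h2 := congr1 (@xi2 R) h; have h3 := congr1 (@xi3 R) h.
have h4 := congr1 (@off1 R) h; have h5 := congr1 (@off2 R) h; have h6 := congr1 (@off3 R) h.
rewrite !coordE in h1 h2 h3 h4 h5 h6.
have H (d e f : octonion R) r : 2^-1 *: (r *: d + r *: d + oconj (omul e f + omul e f)) = d ->
    odot e e * odot f f = (1 - r) ^+ 2 * odot d d.
  have two (v : octonion R) : 2 *: v = v + v by rewrite scaler_nat mulr2n.
  rewrite oconjD -!two -scalerDr scalerA mulVf ?pnatr_eq0 // scale1r => hd.
  have : oconj (omul e f) = (1 - r) *: d by rewrite scalerBl scale1r -{1}hd addrC addKr.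
  move=> /(congr1 (fun v => odot v v)); rewrite odot_conj odot_omul_l odotZl odotZr => ->.
  by rewrite mulrA expr2.
by split; [rewrite expr2|rewrite expr2|rewrite expr2|split; rewrite -addrA -opprD; apply: H].
Qed.

(** A trace below 1 makes the three factors squared in the hypotheses positive. If one of [A], [B],
    [C] is zero, then all are, and the diagonal entries are idempotent reals below 1. Otherwise
    multiplying the relations in pairs determines [B] and [C], with a contradiction. *)
Lemma small_idempotent_real (x y z A B C : R) : 0 <= A -> 0 <= B -> 0 <= C ->
  x ^+ 2 + B + C = x -> y ^+ 2 + C + A = y -> z ^+ 2 + A + B = z ->
  B * C = (1 - y - z) ^+ 2 * A -> C * A = (1 - z - x) ^+ 2 * B ->
  A * B = (1 - x - y) ^+ 2 * C -> x + y + z < 1 ->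
  [/\ x = 0, y = 0, z = 0 & [/\ A = 0, B = 0 & C = 0]].
Proof.
move=> A0 B0 C0 hx hy hz hA hB hC ht.
have x0 : 0 <= x by rewrite -hx !addr_ge0 ?sqr_ge0.
have y0 : 0 <= y by rewrite -hy !addr_ge0 ?sqr_ge0.
have z0 : 0 <= z by rewrite -hz !addr_ge0 ?sqr_ge0.
have px : 0 < 1 - y - z by lra.
have py : 0 < 1 - z - x by lra.
have pz : 0 < 1 - x - y by lra.
have idem0 (w : R) : w ^+ 2 = w -> w < 1 -> w = 0.
  by move=> h w1; have /eqP : w * (w - 1) = 0 by [rewrite mulrBr mulr1 -expr2 h subrr];
   rewrite mulf_eq0 subr_eq0 => /orP[/eqP //|/eqP e]; move: w1; rewrite e ltxx.
have zero : A = 0 -> B = 0 -> C = 0 -> [/\ x = 0, y = 0, z = 0 & [/\ A = 0, B = 0 & C = 0]].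
  by move=> eA eB eC; split => //; apply: idem0; lra.
have sq0 (w v : R) : 0 < w -> w ^+ 2 * v = 0 -> v = 0.
  by move=> hw /eqP; rewrite mulf_eq0 expf_eq0 /= gt_eqF //= => /eqP.
have [eA|nA] := eqVneq A 0.
  apply: zero => //; [apply: (sq0 (1 - z - x))|apply: (sq0 (1 - x - y))] => //.
    by rewrite -hB eA mulr0.
  by rewrite -hC eA mul0r.
have [eB|nB] := eqVneq B 0.
  by case/negP: nA; apply/eqP/(sq0 (1 - y - z)) => //; rewrite -hA eB mul0r.
have [eC|nC] := eqVneq C 0.
  by case/negP: nA; apply/eqP/(sq0 (1 - y - z)) => //; rewrite -hA eC mulr0.
have sqeq (v w : R) : 0 <= v -> 0 <= w -> v ^+ 2 = w ^+ 2 -> v = w.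
  by move=> hv hw /eqP; rewrite eqrXn2 // => /eqP.
have eC : C = (1 - y - z) * (1 - z - x).
  apply: sqeq => //; first by rewrite mulr_ge0 // ltW.
  apply: (mulfI nA); apply: (mulfI nB).
  have := congr2 *%R hA hB; rewrite exprMn; lra.
have eB : B = (1 - y - z) * (1 - x - y).
  apply: sqeq => //; first by rewrite mulr_ge0 // ltW.
  apply: (mulfI nA); apply: (mulfI nC).
  have := congr2 *%R hA hC; rewrite exprMn; lra.
(* With d = 1 - x - y - z > 0, substituting [B] and [C] in [hx] gives d + d^2 = 0. *)
exfalso; nra.
Qed.

Lemma herm3_0 : herm3 0 0 0 0 0 0 = 0 :> albert R.
Proof. by rewrite -[RHS](scale0r (herm3 0 0 0 0 0 0)) herm3Z !mul0r !scale0r. Qed.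

(** This yields primitivity: if an element of trace 1 is a sum of two idempotents, one of them has
    trace below 1. *)
Lemma idempotent_trace_lt1 p : jordan p p = p -> albert_tr p < 1 -> p = 0.
Proof.
case: (herm3_surj p) => r1 [r2 [r3 [a [b [c ->]]]]] /idempotent_coord /= [h1 h2 h3 [h4 h5 h6]].
rewrite herm3_tr => ht.
have [-> -> -> [ha hb hc]] := small_idempotent_real (odot_ge0 a) (odot_ge0 b) (odot_ge0 c) h1
  h2 h3 h4 h5 h6 ht.
by rewrite (odot_eq0 ha) (odot_eq0 hb) (odot_eq0 hc) herm3_0.
Qed.

Lemma albert_trD x y : albert_tr (x + y) = albert_tr x + albert_tr y.
Proof. by rewrite -!trace_form1 trace_formDl. Qed.

(* Primitivity is automatic, which makes the Cayley plane closed, hence Borel. *)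
Lemma cayley_planeE : @cayley_plane R = [set p | jordan p p = p /\ albert_tr p = 1].
Proof.
apply/seteqP; split=> p /= [hp ht]; first by [].
split=> //; split=> //.
  apply/eqP => p0; move: ht; rewrite p0 -(scale0r 0) -trace_form1 trace_formZl mul0r.
  by move/eqP; rewrite eq_sym oner_eq0.
move=> x y hx hy _ e; move: ht; rewrite e albert_trD => ht.
have [lt1|ge1] := ltP (albert_tr x) 1; [left|right]; apply: idempotent_trace_lt1 => //; lra.
Qed.

Lemma cayley_minor p : jordan p p = p -> albert_tr p = 1 ->
  xi1 p * xi2 p = odot (off3 p) (off3 p).
Proof.
case: (herm3_surj p) => r1 [r2 [r3 [a [b [c ->]]]]] /idempotent_coord /= [h1 h2 h3 _].
rewrite herm3_tr !coordE => ht.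
(* Trace 1 makes the diagonal equations homogeneous of degree two in the diagonal entries; the first
   plus the second minus the third is then twice the claim. *)
have e1 : r1 = r1 * (r1 + r2 + r3) by rewrite ht mulr1.
have e2 : r2 = r2 * (r1 + r2 + r3) by rewrite ht mulr1.
have e3 : r3 = r3 * (r1 + r2 + r3) by rewrite ht mulr1.
by have := (etrans h1 e1, etrans h2 e2, etrans h3 e3) => -[[f1 f2] f3]; lra.
Qed.

Lemma isometric_aut1 (g : albert R -> albert R) : isometric_aut g -> g (jone R) = jone R.
Proof.
move=> [[gl [h gh hg] gj] gT].
by rewrite -[LHS]jordan1 -{2}(hg (jone R)) -gj jordanC jordan1 hg.
Qed.

Lemma isometric_aut_tr (g : albert R -> albert R) : isometric_aut g ->
  forall x, albert_tr (g x) = albert_tr x.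
Proof. by move=> hg x; rewrite -!trace_form1 -{1}(isometric_aut1 hg) hg.2. Qed.

Lemma isometric_aut_cayley (g : albert R -> albert R) : isometric_aut g ->
  g @^-1` (@cayley_plane R) = @cayley_plane R.
Proof.
move=> hg; rewrite cayley_planeE; apply/seteqP.
have [[gl gb gj] gT] := hg.
split=> p /=; rewrite isometric_aut_tr // -gj => -[e ->]; split=> //.
  exact: (bij_inj gb).
by rewrite e.
Qed.

Variable mu : probability (borel_albert R) R.
Hypothesis mu_inv : invariant_prob mu.

Definition cubic x y z p : R := trace_form p x * trace_form p y * trace_form p z.

Lemma cubic_measurable x y z :
  measurable_fun setT (fun p : borel_albert R => (cubic x y z p)%:E).
Proof.
apply/measurable_EFinP; do 2?[apply: measurable_funM]; exact: trace_form_measurable.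
Qed.

Lemma cayley_measurable : measurable (@cayley_plane R : set (borel_albert R)).
Proof. by rewrite cayley_planeE; exact: idempotent_trace_measurable. Qed.

Lemma integral_isometric_aut (g : albert R -> albert R) (f : borel_albert R -> \bar R) :
  isometric_aut g -> measurable_fun setT f ->
  (\int[mu]_(p in @cayley_plane R) f (g p) = \int[mu]_(p in @cayley_plane R) f p)%E.
Proof.
move=> hg mf; have [[gl gb gj] gT] := hg.
have mg : measurable_fun setT (g : borel_albert R -> borel_albert R) := linear_measurable gl.
have mC := cayley_measurable.
(* Nothing is assumed about integrability of [f], so the change of variables is made for nonnegative
   functions and then applied to the positive and negative parts. *)
have ge0 (h : borel_albert R -> \bar R) : measurable_fun setT h -> (forall p, 0 <= h p)%E ->
   (\int[mu]_(p in @cayley_plane R) h (g p) = \int[mu]_(p in @cayley_plane R) h p)%E.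
  move=> mh h0.
  rewrite -[in LHS](isometric_aut_cayley hg).
  rewrite -(@ge0_integral_pushforward _ _ (borel_albert R) (borel_albert R) R g mg mu _ h mC)
    //.
    apply: eq_measure_integral => A mA _.
    by rewrite /pushforward; apply: mu_inv.2.
  exact: measurable_funTS.
rewrite integralE [RHS]integralE.
rewrite -(ge0 (f^\+)%E) ?funepos_ge0 //; last exact: measurable_funepos.
rewrite -(ge0 (f^\-)%E) ?funeneg_ge0 //; last exact: measurable_funeneg.
congr (_ - _)%E; apply: eq_integral => p _.
  by rewrite -[RHS]/((f^\+ \o g)%E p) -funepos_comp.
by rewrite -[RHS]/((f^\- \o g)%E p) -funeneg_comp.
Qed.

End CayleyPlane.

Lemma trace_formE (R : realType) (x y : albert R) : trace_form x y = albert_tr (jordan x y).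
Proof. by []. Qed.

Definition cubic_avg (R : realType) (D : {fset albert R}) (x y z : albert R) : R :=
  #|` D|%:R^-1 * \sum_(p <- D) cubic x y z p.

Definition cubic_target (R : realType) (x y z : albert R) : R :=
  trace_form (jordan x y) z + 2 * (albert_tr x * trace_form y z +
    albert_tr y * trace_form x z + albert_tr z * trace_form x y) +
  8 * (albert_tr x * albert_tr y * albert_tr z).

Opaque trace_form albert_tr jordan herm3.

(* Without generalization, [ring] and [lra] compare these atoms up to conversion,
   which unfolds the matrices. *)
Ltac abstract_forms := repeat match goal with
  | |- context [trace_form ?x ?y] => generalize (trace_form x y)
  | |- context [albert_tr ?x] => generalize (albert_tr x)
  | |- context [cubic_avg ?D ?x ?y ?z] => generalize (cubic_avg D x y z)
  | |- context [cubic_target ?x ?y ?z] => generalize (cubic_target x y z)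
  | |- context [odot ?x ?y] => generalize (odot x y)
  end; intros.
Ltac form_ring := abstract_forms; ring.

(** * The cubic average of a 3-design *)

Section Design.
Variable R : realType.
Implicit Types (r s t : R) (a b c u : octonion R) (x y z p q : albert R).

(** A named function into [R^o] can carry the linear structure that [polynomial_deg_le] requires. *)
Definition trace_form_lin y (p : albert R) : R^o := trace_form p y.

Lemma trace_form_linear y : linear (trace_form_lin y).
Proof. by move=> k p q; rewrite /trace_form_lin trace_formDl trace_formZl. Qed.

HB.instance Definition _ y := GRing.isLinear.Build R (albert R) R^o _ (trace_form_lin y)
  (@trace_form_linear y).

Lemma prod_ord3 (f : nat -> R) : \prod_(i < 3) f i = f 0%N * f 1%N * f 2%N.
Proof. by rewrite !big_ord_recr big_ord0 /= mul1r. Qed.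

Lemma cubic_poly x y z : polynomial_deg_le 3 (cubic x y z).
Proof.
exists 3, (fun i : 'I_3 => trace_form_lin (nth 0 [:: x; y; z] i) : {linear albert R -> R^o}),
 (mpoly.mpolyX R (mpoly.Multinom [tuple 1%N | i < 3])).
split.
  rewrite mpoly.msizeX mpoly.mdegE (eq_bigr (fun=> 1%N)) ?sum1_card ?card_ord // => i _.
  exact: mpoly.mnmE.
move=> p; rewrite mpoly.mevalX.
rewrite (eq_bigr (fun i : 'I_3 => trace_form p (nth 0 [:: x; y; z] i))).
  exact/esym/(prod_ord3 (fun i => trace_form p (nth 0 [:: x; y; z] i))).
by move=> i _; rewrite mpoly.mnmE expr1.
Qed.

Lemma albert_trZ r x : albert_tr (r *: x) = r * albert_tr x.
Proof. by rewrite -!trace_form1 trace_formZl. Qed.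

Lemma cubic_targetD x y z x' :
  cubic_target (x + x') y z = cubic_target x y z + cubic_target x' y z.
Proof.
rewrite /cubic_target jordanDl !trace_formDl albert_trD; form_ring.
Qed.

Lemma cubic_targetZ r x y z : cubic_target (r *: x) y z = r * cubic_target x y z.
Proof.
rewrite /cubic_target jordanZl !trace_formZl albert_trZ; form_ring.
Qed.

Lemma cubic_target12 x y z : cubic_target x y z = cubic_target y x z.
Proof. rewrite /cubic_target (jordanC y) (trace_formC y x); form_ring. Qed.

Lemma cubic_target23 x y z : cubic_target x y z = cubic_target x z y.
Proof.
rewrite /cubic_target (trace_formC z y) trace_form_assoc (jordanC y) -trace_form_assoc;
  form_ring.
Qed.

Lemma cubic_target_isom (g : albert R -> albert R) x y z : isometric_aut g ->
  cubic_target (g x) (g y) (g z) = cubic_target x y z.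
Proof.
move=> hg; have [[_ _ gj] gT] := hg.
by rewrite /cubic_target -gj !gT !(isometric_aut_tr hg).
Qed.

Lemma albert_tr_jone : albert_tr (jone R) = 3.
Proof. rewrite /jone herm3_tr; form_ring. Qed.

Lemma cubic_target1 : cubic_target (jone R) (jone R) (jone R) = 273.
Proof. rewrite /cubic_target jordan1 !trace_form1 albert_tr_jone; form_ring. Qed.

Lemma diag01 : jordan (diag_unit R ord0) (diag_unit R (inord 1)) = 0.
Proof.
rewrite /diag_unit herm3_jordan !ord3_eq !eqxx -herm3_0.
by apply: herm3_congr; rewrite ?odot0 ?scaler0 ?omul0 ?addr0 ?oconj0 ?scaler0 ?mulr0 ?mul0r
  ?addr0 ?scaler0.
Qed.

Lemma off_sqr u : odot u u = 1 ->
  jordan (offdiag (inord 2) u) (offdiag (inord 2) u) = diag_unit R ord0 + diag_unit R (inord 1).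
Proof.
move=> hu; rewrite /diag_unit /offdiag herm3D herm3_jordan !ord3_eq !eqxx !odot0 hu.
by apply: herm3_congr; rewrite ?scaler0 ?omul0 ?o0mul ?addr0 ?oconj0 ?scale0r ?scaler0 ?mulr0
  ?mul0r ?addr0 ?add0r ?scaler0.
Qed.

(** Both sides equal 8 times T(x, E0) + T(x, E1) + 4 Tr x, where E0 and E1 are the first two
    diagonal idempotents: their product is 0, and each unit [u] gives an off-diagonal element with
    square E0 + E1 and T-norm 2. *)
Lemma cubic_target_rel x :
  4 * cubic_target x (diag_unit R ord0) (diag_unit R (inord 1)) =
  \sum_(u <- obasis R) cubic_target x (offdiag (inord 2) u) (offdiag (inord 2) u).
Proof.
have td i : albert_tr (diag_unit R i) = 1.
  rewrite /diag_unit herm3_tr; elim/ord3_ind: i; rewrite !ord3_eq ?eqxx /= ?addr0 ?add0r //.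
have to i u : albert_tr (offdiag i u) = 0 by rewrite /offdiag herm3_tr !addr0.
have e u : odot u u = 1 -> cubic_target x (offdiag (inord 2) u) (offdiag (inord 2) u) =
    trace_form x (diag_unit R ord0) + trace_form x (diag_unit R (inord 1)) + 4 * albert_tr x.
  move=> hu; rewrite /cubic_target !to trace_form_assoc off_sqr // (trace_formC x) trace_formDl.
  rewrite !(trace_formC x) [trace_form (offdiag _ u) (offdiag _ _)]trace_form_off.
  rewrite !ord3_eq /offdiag herm3_off3 eqxx hu; form_ring.

rewrite [RHS](_ : _ = \sum_(u <- obasis R) (trace_form x (diag_unit R ord0) +
      trace_form x (diag_unit R (inord 1)) + 4 * albert_tr x)); last first.
  by apply: eq_big_seq => u /obasis_unit /e.
rewrite !big_cons big_nil /cubic_target trace_form_assoc diag01 !td.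
have -> : trace_form x 0 = 0 by rewrite trace_formC -(scale0r 0) trace_formZl mul0r.
have -> : trace_form (diag_unit R ord0) (diag_unit R (inord 1)) = 0.
  by rewrite trace_formE diag01 -(scale0r 0) albert_trZ mul0r.
form_ring.
Qed.

Section Averages.
Variable mu : probability (borel_albert R) R.
Hypothesis mu_inv : invariant_prob mu.
Variable D : {fset albert R}.
Hypothesis hD : projective_design mu 3 D.
Local Notation avg := (cubic_avg D).

Lemma design_cayley p : p \in D -> jordan p p = p /\ albert_tr p = 1.
Proof. by move=> pD; have := hD.1 p pD; rewrite cayley_planeE. Qed.

Lemma cubic_avg_integral x y z :
  (avg x y z)%:E = (\int[mu]_(p in @cayley_plane R) (cubic x y z p)%:E)%E.
Proof. exact/(hD.2)/cubic_poly. Qed.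

(** The set [D] need not be stable under [g]; invariance comes from the integral, which equals the
    average because [cubic] has degree 3. *)
Lemma cubic_avg_isom (g : albert R -> albert R) x y z : isometric_aut g ->
  avg (g x) (g y) (g z) = avg x y z.
Proof.
move=> hg; have [_ gT] := hg.
apply: EFin_inj; apply: etrans (cubic_avg_integral _ _ _) _.
apply: etrans (esym (integral_isometric_aut mu_inv hg (cubic_measurable (g x) (g y) (g z)))) _.
apply: etrans _ (esym (cubic_avg_integral x y z)).
by apply: eq_integral => p _; rewrite /cubic !gT.
Qed.

Lemma cubic_avg1 : avg (jone R) (jone R) (jone R) = 1.
Proof.
apply: EFin_inj; rewrite cubic_avg_integral.
have [mu1 _] := mu_inv.
transitivity (\int[mu]_(p in @cayley_plane R) (cst 1%E) p)%E; last first.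
  rewrite integral_cst; first by rewrite mul1e; exact: mu1.
  exact: (@cayley_measurable R).
apply: eq_integral => p; rewrite inE cayley_planeE => -[_ hp].
by rewrite /cubic !trace_form1 hp !mul1r.
Qed.

Lemma cubic_avg_rel x :
  4 * avg x (diag_unit R ord0) (diag_unit R (inord 1)) =
  \sum_(u <- obasis R) avg x (offdiag (inord 2) u) (offdiag (inord 2) u).
Proof.
rewrite /cubic_avg -big_distrr /= mulrCA; congr (_ * _).
rewrite exchange_big mulr_sumr /=; apply: eq_big_seq => p /design_cayley [hp tp].
rewrite /cubic !trace_form_diag !ord3_eq !eqxx.
rewrite (eq_bigr (fun u => 4 * trace_form p x * odot (off3 p) u ^+ 2)); last first.
  by move=> u _; rewrite !trace_form_off !ord3_eq; form_ring.
by rewrite -mulr_sumr obasis_sqr -cayley_minor // !mulrA.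
Qed.

Lemma cubic_avgD x x' y z : avg (x + x') y z = avg x y z + avg x' y z.
Proof.
rewrite /cubic_avg -mulrDr -big_split /=; congr (_ * _); apply: eq_bigr => p _.
by rewrite /cubic trace_formC trace_formDl !(trace_formC _ p); form_ring.
Qed.

Lemma cubic_avgZ r x y z : avg (r *: x) y z = r * avg x y z.
Proof.
rewrite /cubic_avg [in RHS]mulrCA; congr (_ * _); rewrite mulr_sumr; apply: eq_bigr => p _.
by rewrite /cubic trace_formC trace_formZl (trace_formC _ p); form_ring.
Qed.

Lemma cubic_avg12 x y z : avg x y z = avg y x z.
Proof.
apply: (congr1 ( *%R _)); apply: eq_bigr => p _.
by rewrite /cubic; form_ring.
Qed.

Lemma cubic_avg23 x y z : avg x y z = avg x z y.
Proof.
apply: (congr1 ( *%R _)); apply: eq_bigr => p _.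
by rewrite /cubic; form_ring.
Qed.

Lemma cubic_avgE x y z : 273 * avg x y z = cubic_target x y z.
Proof.
apply/eqP; rewrite -subr_eq0; apply/eqP.
apply: (@invariant_trilinear_eq0 _ (fun x y z => 273 * avg x y z - cubic_target x y z)).
- by move=> *; rewrite cubic_avgD cubic_targetD; form_ring.
- by move=> *; rewrite cubic_avgZ cubic_targetZ; form_ring.
- by move=> x' y' z'; rewrite cubic_target12 cubic_avg12.
- by move=> x' y' z'; rewrite cubic_target23 cubic_avg23.
- by move=> g hg x' y' z'; rewrite cubic_avg_isom // cubic_target_isom.
- by rewrite cubic_avg1 cubic_target1; form_ring.
- by move=> x'; rewrite sumrB -mulr_sumr -cubic_avg_rel -cubic_target_rel; form_ring.
Qed.

End Averages.
End Design.

(** * Lower moments and the reconstruction formula *)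

Section Moments.
Variable R : realType.
Implicit Types (r s t : R) (x y z p q : albert R).
Variable mu : probability (borel_albert R) R.
Hypothesis mu_inv : invariant_prob mu.
Variable D : {fset albert R}.
Hypothesis hD : projective_design mu 3 D.
Local Notation N := (#|` D|%:R : R).

Lemma second_moment x y :
  39 * (N^-1 * \sum_(p : D) trace_form (val p) x * trace_form (val p) y) =
  trace_form x y + 4 * (albert_tr x * albert_tr y).
Proof.
have := cubic_avgE mu_inv hD x y (jone R).
rewrite /cubic_target !trace_form1 albert_tr_jone -trace_formE /cubic_avg.
have -> : \sum_(p <- D) cubic x y (jone R) p = \sum_(p : D) trace_form (val p) x * trace_form
  (val p) y.
  rewrite big_seq_fsetE; apply: eq_bigr => p _.
  by rewrite /cubic trace_form1 (design_cayley hD (valP p)).2 mulr1.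
(* At z = 1 the target is 7 T(x,y) + 28 Tr x Tr y, and 273 = 7 * 39. *)
abstract_forms; lra.
Qed.

Lemma first_moment y : 3 * (N^-1 * \sum_(p : D) trace_form (val p) y) = albert_tr y.
Proof.
have := second_moment (jone R) y; rewrite trace_formC trace_form1 albert_tr_jone.
rewrite (eq_bigr (fun p : D => trace_form (val p) y)); first by (abstract_forms; lra).
by move=> p _; rewrite trace_form1 (design_cayley hD (valP p)).2 mul1r.
Qed.

(** The trace term is chosen to cancel 4 Tr x Tr y in the second moment, since the first moment of
    T(p,y) is a third of Tr y. *)
Definition frame_coef x p : R := 39 * trace_form p x - 12 * albert_tr x.

Lemma frame_identity x y :
  N^-1 * (\sum_(p : D) frame_coef x (val p) * trace_form (val p) y) = trace_form x y.
Proof.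
have h1 := second_moment x y; have h2 := first_moment y.
rewrite (eq_bigr (fun p : D => 39 * (trace_form (val p) x * trace_form (val p) y) -
   12 * albert_tr x * trace_form (val p) y)); last by move=> p _; rewrite /frame_coef;
     form_ring.
rewrite sumrB -!mulr_sumr mulrBr mulrCA h1 [N^-1 * _]mulrCA -h2; form_ring.
Qed.

(** A 3-design spans J: the frame identity expresses T(z,z) through the numbers T(p,z). *)
Lemma design_nondegenerate z :
  (forall p : D, trace_form z (val p) = 0) -> z = 0.
Proof.
move=> h; apply: trace_form_eq0; rewrite -frame_identity big1 ?mulr0 // => p _.
by rewrite [trace_form _ z]trace_formC h mulr0.
Qed.

End Moments.

(** * The automorphism extending [phi], and its uniqueness *)

Lemma trace_formBl (R : realType) (x y z : albert R) :
  trace_form (x - y) z = trace_form x z - trace_form y z.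
Proof. by rewrite trace_formDl -scaleN1r trace_formZl mulN1r. Qed.

Section Linear.
Variables (R : realType) (I : finType).
Implicit Types (x y : albert R).

Lemma trace_form_suml (c : I -> R) (v : I -> albert R) y :
  trace_form (\sum_i c i *: v i) y = \sum_i c i * trace_form (v i) y.
Proof.
elim/big_rec2: _ => [|i a x _ <-]; first by rewrite -(scale0r 0) trace_formZl mul0r.
by rewrite trace_formDl trace_formZl.
Qed.

Lemma linear_sum_comb (g : albert R -> albert R) r (c : I -> R) (v : I -> albert R) :
  linear g -> g (r *: \sum_i c i *: v i) = r *: \sum_i c i *: g (v i).
Proof.
move=> gl.
have [gD g0 gZ] := linear_morphisms gl.
rewrite gZ; congr (_ *: _); elim/big_rec2: _ => [//|i x y _ <-].
by rewrite gD gZ.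
Qed.
End Linear.

Theorem lemma5p3 (R : realType) (mu : probability (borel_albert R) R)
    (mu_inv : invariant_prob mu)
    (D D' : {fset albert R})
    (hD : projective_design mu 3 D) (hD' : projective_design mu 3 D')
    (phi : D -> D') (phi_bij : bijective phi)
    (phi_angle : forall p q : D,
      trace_form (val (phi p)) (val (phi q)) = trace_form (val p) (val q)) :
  exists! g : albert R -> albert R,
    albert_aut g /\ forall p : D, g (val p) = val (phi p).
Proof.
set N : R := #|` D|%:R.
have hN : #|` D'|%:R = N by rewrite /N !cardfE (bij_eq_card phi_bij).
have sumD' (f : albert R -> R) : \sum_(p : D') f (val p) = \sum_(p : D) f (val (phi p)).
  by rewrite (reindex phi) //; exact: onW_bij.
have nd' z : (forall p : D, trace_form z (val (phi p)) = 0) -> z = 0.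
  move=> h; apply: (design_nondegenerate mu_inv hD') => q.
  by have [psi _ psiK] := phi_bij; rewrite -(psiK q).
have recon x : x = N^-1 *: \sum_(p : D) frame_coef x (val p) *: val p.
  apply/eqP; rewrite -subr_eq0; apply/eqP; apply: trace_form_eq0.
  (* The residual is tested against itself; naming it keeps the second argument from being expanded
     along with the first. *)
  set z := (X in trace_form _ X); rewrite trace_formBl !trace_formZl trace_form_suml.
  by rewrite (frame_identity mu_inv hD); form_ring.
have recon' y : y = N^-1 *: \sum_(p : D) frame_coef y (val (phi p)) *: val (phi p).
  apply/eqP; rewrite -subr_eq0; apply/eqP; apply: trace_form_eq0.
  set z := (X in trace_form _ X); rewrite trace_formBl !trace_formZl trace_form_suml.
  have := frame_identity mu_inv hD' y z; rewrite hN.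
  by rewrite (sumD' (fun p => frame_coef y p * trace_form p z)) => ->; form_ring.
pose g x : albert R := N^-1 *: \sum_(p : D) frame_coef x (val p) *: val (phi p).
pose h x : albert R := N^-1 *: \sum_(p : D) frame_coef x (val (phi p)) *: val p.
have coefD k x y p : frame_coef (k *: x + y) p = k * frame_coef x p + frame_coef y p.
  rewrite /frame_coef trace_formC trace_formDl trace_formZl albert_trD albert_trZ
    !(trace_formC _ p); form_ring.
have glin : linear g.
  move=> k x y; rewrite /g scalerA mulrC -scalerA -scalerDr; congr (_ *: _).
  rewrite scaler_sumr -big_split; apply: eq_bigr => p _.
  by rewrite coefD scalerDl scalerA.
have gphi x q : trace_form (g x) (val (phi q)) = trace_form x (val q).
  rewrite /g trace_formZl trace_form_suml -(frame_identity mu_inv hD x).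
  by apply: (congr1 ( *%R _)); apply: eq_bigr => p _; rewrite phi_angle.
have gval p : g (val p) = val (phi p).
  apply/eqP; rewrite -subr_eq0; apply/eqP; apply: nd' => q.
  rewrite trace_formBl gphi phi_angle. exact: subrr.
have gT x y : trace_form (g x) (g y) = trace_form x y.
  rewrite [LHS]trace_formC {1}/g trace_formZl trace_form_suml.
  rewrite [RHS]trace_formC -(frame_identity mu_inv hD y).
  by apply: (congr1 ( *%R _)); apply: eq_bigr => p _; rewrite trace_formC gphi trace_formC.
(* It is not yet known that [g] fixes the unit, so the trace is recovered from the first moments of
   the two designs. *)
have gtr x : albert_tr (g x) = albert_tr x.
  rewrite -(first_moment mu_inv hD') -(first_moment mu_inv hD) hN.
  rewrite (sumD' (fun p => trace_form p (g x))); do 2!apply: (congr1 ( *%R _)).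
  by apply: eq_bigr => p _; rewrite trace_formC gphi trace_formC.
(* The two cubic averages agree term by term along [phi], and [g] preserves every other term of the
   target, so the Jordan term is preserved as well. *)
have gcubic x y w : trace_form (g (jordan x y)) (g w) = trace_form (jordan (g x) (g y)) (g w).
  have := cubic_avgE mu_inv hD x y w.
  have := cubic_avgE mu_inv hD' (g x) (g y) (g w).
  have -> : cubic_avg D' (g x) (g y) (g w) = cubic_avg D x y w.
    rewrite /cubic_avg hN; apply: (congr1 ( *%R _)); rewrite !big_seq_fsetE /=.
    rewrite (sumD' (cubic (g x) (g y) (g w))); apply: eq_bigr => p _.
    by rewrite /cubic -gval !gT.
  by rewrite /cubic_target !gtr !gT; abstract_forms; lra.
have gjordan x y : g (jordan x y) = jordan (g x) (g y).
  apply/eqP; rewrite -subr_eq0; apply/eqP; apply: nd' => q.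
  by rewrite trace_formBl -gval gcubic; exact: subrr.
have gh : cancel h g.
  move=> y; rewrite [RHS]recon' /h linear_sum_comb //.
  by apply: (congr1 ( *:%R _)); apply: eq_bigr => p _; rewrite gval.
have hg : cancel g h.
  move=> x; rewrite [RHS]recon /h; congr (_ *: _); apply: eq_bigr => p _.
  by congr (_ *: _); rewrite /frame_coef gtr trace_formC gphi trace_formC.
exists g; split.
  by split=> //; split=> //; exists h.
(* By [recon] a linear map is determined by its values on [D]. *)
move=> g' [[gl' _ _] gval']; apply: funext => x.
rewrite [in RHS](recon x) linear_sum_comb // /g.
by apply: (congr1 ( *:%R _)); apply: eq_bigr => p _; rewrite gval'.
Qed.
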